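(* Let $a\in\mathbb R$, $b>0$, and let $F$ be a distribution supported in $[a,a+b]$ with mean $1$ and density function $f$. If there exists $h>0$ such that $f>\frac{3b}{4h}$ on $[1-h,1+h]$, then $F\in\mathcal D_2^{\mathrm U}$, i.e. there exist random variables $X_1,X_2$, each uniformly distributed on $[0,1]$, such that $X_1+X_2$ has distribution $F$.
   Context: $\mathcal D_2^{\mathrm U}$ is the set of all distributions of $X_1+X_2$, where $X_1,X_2$ are random variables on a common atomless probability space, each uniformly distributed on $[0,1]$, with arbitrary joint distribution. *)

(* Defs.v *)
From mathcomp Require Import all_boot all_order all_algebra.
From mathcomp Require Import all_classical all_reals all_analysis.
Import Order.TTheory GRing.Theory Num.Theory.
Import numFieldNormedType.Exports.

Set Implicit Arguments.
Unset Strict Implicit.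
Unset Printing Implicit Defensive.

Local Open Scope classical_set_scope.
Local Open Scope ring_scope.

(* Laws are compared on Borel sets only: MathComp-Analysis measures are total
   functions on all subsets, and their values on non-measurable sets are
   meaningless.  For a random variable [X], [pushforward P X] is what
   [distribution P X] unfolds to; it also applies directly to [X1 \+ X2]. *)
Definition has_law (R : realType) (d : measure_display) (T : measurableType d)
    (P : probability T R) (X : T -> measurableTypeR R)
    (mu : probability (measurableTypeR R) R) : Prop :=
  forall B : set (measurableTypeR R), measurable B ->
    pushforward P X B = mu B.

Definition atomless (R : realType) (d : measure_display)
    (T : measurableType d) (P : probability T R) : Prop :=
  forall A : set T, measurable A -> (0 < P A)%E ->
    exists B : set T, [/\ measurable B, B `<=` A & (0 < P B < P A)%E].

Definition D2U (R : realType) : set (probability (measurableTypeR R) R) :=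
  [set F | exists (d : measure_display) (T : measurableType d)
      (P : probability T R) (X1 X2 : {RV P >-> R}),
    [/\ atomless P,
        has_law P X1 (uniform_prob (@ltr01 R)),
        has_law P X2 (uniform_prob (@ltr01 R)) &
        has_law P (X1 \+ X2) F]].

Definition is_density (R : realType)
    (F : probability (measurableTypeR R) R) (f : R -> R) : Prop :=
  [/\ measurable_fun setT f,
      forall x : R, 0 <= f x &
      forall B : set (measurableTypeR R), measurable B ->
        F B = (\int[lebesgue_measure]_(x in B) (f x)%:E)%E].

(* Main.v *)
Require Import Defs.
From HB Require Import structures.
From mathcomp Require Import all_boot all_order all_algebra.
From mathcomp Require Import all_classical all_reals all_analysis.
From mathcomp Require Import measurable_realfun.
From mathcomp Require Import ring lra.
Import Order.TTheory GRing.Theory Num.Theory.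
Import numFieldNormedType.Exports.

Set Implicit Arguments.
Unset Strict Implicit.
Unset Printing Implicit Defensive.

Local Open Scope classical_set_scope.
Local Open Scope ring_scope.

(* With X = X1 and Y = 1 - X2 one has X1 + X2 = 1 + (X - Y), so X and Y have to
   be uniform on [0, 1] with X - Y distributed as F - 1.  Take out of F - 1 the
   uniform density 3b/(4h) on [-h, h], of mass m = 3b/2.  What is left has a
   density g of mean zero, hence is a mixture of centered two-point laws on
   {-u, v}, where (u, v) has density proportional to (u + v) g(-u) g(v).
   On an interval of length u + v a rotation by u is a coupling of uniform laws
   whose difference has this two-point law.  Fill [0, 1] with as many such
   intervals as possible while leaving an interval of length l > h uncovered:
   then l <= h + b.  A pair of weight w uses the share w / (1 - l) of the whole
   space, and these shares sum to at most (1 - m) / (1 - h - b) <= 1.  The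
   uncovered intervals must contribute the uniform law on [-h, h]; on [0, l]
   this is achieved by X = |x| and Y = |x + t|, where x is uniform on the circle
   of length 2l and t is random in [0, h]. *)

(** * Invariance of Lebesgue measure *)

(** The constant 3/4 comes from the bound on the shares, which needs [h + b <= m]. Positivity of [f]
    on [1 - h, 1 + h] forces this interval into [a, a + b], so 2h <= b and m = 3b/2 suffices; spread
    over length 2h this is the height 3b/(4h). As the hypothesis is strict, [g] keeps mass on both
    sides of 0: hence m < 1, and the integrals of u g(-u) and v g(v) over u, v > 0 have a common
    positive value kappa, which normalises the mixture. A share with n tiles spends length n (u + v)
    on its two-point law, so the shares have density g(-u) g(v) / (kappa n). The uncovered length
    varies with (u, v), but only its average matters: it is 1 - (1 - m) = m whatever the numbers of
    tiles, exactly the mass of the uniform part. The slack l > h keeps the density of t,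
    proportional to 1/(l - t)^2, away from its pole. All shares are realised together by one density
    in (u, v, t, x), and each law is read off by integrating a nonnegative test function [G], so
    that Tonelli's theorem takes the place of conditional distributions. *)

Local Notation lam := (@lebesgue_measure _).

Section measurability.
Context d (T : measurableType d) (R : realType).

Lemma measurable_funV (f : T -> R) :
  measurable_fun setT f -> measurable_fun setT (fun x => (f x)^-1).
Proof.
move=> mf.
(* The real power -1 is applied to the nonnegative function f^2, where it is the inverse; the factor
   [f x] restores the sign and makes both sides vanish when [f x = 0]. *)
have -> : (fun x => (f x)^-1) = (fun x => f x * ((f x * f x) `^ (-1))).
  apply/funext => x; have [->|f0] := eqVneq (f x) 0.
    by rewrite mul0r invr0.
  rewrite powR_inv1; last by rewrite -expr2 sqr_ge0.
  by rewrite invfM mulrA divff// mul1r.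
apply: measurable_funM => //.
apply: (@measurableT_comp _ _ _ _ _ _ (@powR R ^~ (-1))) => //.
exact: measurable_funM.
Qed.

Lemma measurable_fun_floor (f : T -> R) :
  measurable_fun setT f -> measurable_fun setT (fun x => (Num.floor (f x))%:~R : R).
Proof.
move=> mf; apply: (@measurableT_comp _ _ _ _ _ _ (fun y : R => (Num.floor y)%:~R : R)) => //.
apply: nondecreasing_measurable => // x y xy.
by rewrite ler_int; exact: le_floor.
Qed.

End measurability.

Section lebesgue_invariance.
Context (R : realType).
Implicit Types (F : R -> \bar R) (a b c : R).

Lemma lebesgue_measureD c (A : set R) : measurable A ->
  pushforward lam (fun x : R => x + c : measurableTypeR R) A = lam A.
Proof.
move=> mA; apply/esym/lebesgue_measure_unique => //=; first exact: measurable_funD.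
move=> _ _ [[x y]] _ <-.
rewrite /pushforward.
have -> : (fun z : R => z + c) @^-1` `]x, y] = `]x - c, y - c]%classic.
  by apply/seteqP; split => z /=; rewrite !in_itv/= ltrBlDr lerBrDr.
rewrite !lebesgue_measure_itv/= !lte_fin ltrD2r.
by case: ifP => // _; rewrite -!EFinB; congr EFin; ring.
Qed.

Lemma ge0_integral_shift c F : measurable_fun setT F -> (forall x, (0 <= F x)%E) ->
  (\int[lam]_x F (x + c)%R = \int[lam]_x F x)%E.
Proof.
move=> mF F0.
have mc : measurable_fun setT (fun x : R => x + c : measurableTypeR R).
  exact: measurable_funD.
transitivity (\int[pushforward lam (fun x : R => (x + c)%R : measurableTypeR R)]_x F x)%E.
  by rewrite ge0_integral_pushforward.
by apply: eq_measure_integral => A mA _; exact: lebesgue_measureD.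
Qed.

Lemma ge0_integral_opp F : measurable_fun setT F -> (forall x, (0 <= F x)%E) ->
  (\int[lam]_x F (- x)%R = \int[lam]_x F x)%E.
Proof.
move=> mF F0.
transitivity (\int[pushforward lam (-%R%R : R -> measurableTypeR R)]_x F x)%E.
  by rewrite ge0_integral_pushforward.
by apply: eq_measure_integral => A mA _; exact: lebesgue_measureN.
Qed.

Lemma integral_itv_if a b F :
  (\int[lam]_(x in `[a, b[) F x = \int[lam]_x (if (a <= x < b)%R then F x else 0))%E.
Proof.
rewrite integral_mkcond; apply: eq_integral => x _; rewrite patchE.
by congr (if _ then _ else _); apply/idP/idP; rewrite inE/= in_itv.
Qed.

Lemma measurable_if_itv d (T : measurableType d) (F : T -> \bar R) (p q r : T -> R) :
  measurable_fun setT F -> measurable_fun setT p -> measurable_fun setT q ->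
  measurable_fun setT r ->
  measurable_fun setT (fun x => if p x <= q x < r x then F x else 0%E).
Proof.
move=> mF mp mq mr; apply: measurable_fun_ifT => //.
by apply: measurable_and; [exact: measurable_fun_ler|exact: measurable_fun_ltr].
Qed.

Lemma integral_itv_shift a b c F : measurable_fun setT F -> (forall x, (0 <= F x)%E) ->
  (\int[lam]_(x in `[a, b[) F (x + c)%R = \int[lam]_(x in `[(a + c)%R, (b + c)%R[) F x)%E.
Proof.
move=> mF F0; rewrite !integral_itv_if -[RHS](ge0_integral_shift c).
- by apply: eq_integral => x _ /=; rewrite lerD2r ltrD2r.
- exact: measurable_if_itv.
- by move=> x; case: ifP.
Qed.

(** Reflection turns [a, b[ into an interval open on the left. Endpoints being null, everything can
    stay with intervals [a, b[, which split without overlap. *)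
Lemma integral_itv_oc_co a b F : measurable_fun setT F ->
  (\int[lam]_(x in `]a, b]) F x = \int[lam]_(x in `[a, b[) F x)%E.
Proof. by move=> mF; rewrite !integral_itv_bndoo//; exact: measurable_funTS. Qed.

Lemma integral_itv_opp a b F : measurable_fun setT F -> (forall x, (0 <= F x)%E) ->
  (\int[lam]_(x in `[a, b[) F (- x)%R = \int[lam]_(x in `[(- b)%R, (- a)%R[) F x)%E.
Proof.
move=> mF F0.
have mFo : measurable_fun setT (fun x : R => F (- x)) by exact: measurableT_comp.
rewrite -integral_itv_oc_co// integral_mkcond integral_itv_if -[RHS]ge0_integral_opp.
- apply: eq_integral => x _ /=; rewrite patchE lerN2 ltrN2 andbC.
  by congr (if _ then _ else _); apply/idP/idP; rewrite inE/= in_itv.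
- exact: measurable_if_itv.
- by move=> x; case: ifP.
Qed.

Lemma integral_itv_split a b c F : measurable_fun setT F -> (forall x, (0 <= F x)%E) ->
  a <= c -> c <= b ->
  (\int[lam]_(x in `[a, b[) F x =
   \int[lam]_(x in `[a, c[) F x + \int[lam]_(x in `[c, b[) F x)%E.
Proof.
move=> mF F0 ac cb.
have -> : `[a, b[%classic = `[a, c[%classic `|` `[c, b[%classic.
  by rewrite -itv_bndbnd_setU// bnd_simp.
rewrite ge0_integral_setU//; first exact: measurable_funTS.
apply/disj_set2P; rewrite -subset0 => x [] /=; rewrite !in_itv/=.
by move=> /andP[_ xc] /andP[cx _]; move: (lt_le_trans xc cx); rewrite ltxx.
Qed.

Lemma integral_itv_cst a b (r : \bar R) : a <= b ->
  (\int[lam]_(x in `[a, b[) r = (b - a)%:E * r)%E.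
Proof.
move=> ab; rewrite integral_cst//= lebesgue_measure_itv/= lte_fin.
case: ltP => [_|ba]; first by rewrite -EFinB muleC.
by have -> : a = b by [apply/le_anti/andP]; rewrite subrr mule0 mul0e.
Qed.

Lemma eq_integral_itv a b F G : (forall x, a <= x < b -> F x = G x) ->
  (\int[lam]_(x in `[a, b[) F x = \int[lam]_(x in `[a, b[) G x)%E.
Proof. by move=> FG; apply: eq_integral => x; rewrite inE/= in_itv/= => /FG. Qed.

Lemma lebesgue_measureM c (A : set R) : 0 < c -> measurable A ->
  (c%:E * pushforward lam (fun x : R => (c * x)%R : measurableTypeR R) A = lam A)%E.
Proof.
move=> c0 mA.
have mc : measurable_fun setT (fun x : R => c * x : measurableTypeR R).
  exact: measurable_funM.
pose nu := mscale (NngNum (ltW c0))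
  (measure_function_pushforward__canonical__measure_function_Measure lam mc).
transitivity (nu A) => //.
apply/esym/lebesgue_measure_unique => //= _ [[x y]] _ <-.
rewrite /nu /mscale/= /pushforward.
have -> : (fun z : R => c * z) @^-1` `]x, y] = `]x / c, y / c]%classic.
  by apply/seteqP; split => z /=; rewrite !in_itv/= ltr_pdivrMr// ler_pdivlMr// ![_ * c]mulrC.
rewrite !lebesgue_measure_itv/= !lte_fin ltr_pM2r ?invr_gt0//.
case: ifP => _; last by rewrite mule0.
by rewrite -!EFinB -EFinM; congr EFin; field; rewrite gt_eqF.
Qed.

Lemma ge0_integral_scale c F : 0 < c -> measurable_fun setT F -> (forall x, (0 <= F x)%E) ->
  (c%:E * \int[lam]_x F (c * x)%R = \int[lam]_x F x)%E.
Proof.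
move=> c0 mF F0.
have mc : measurable_fun setT (fun x : R => c * x : measurableTypeR R).
  exact: measurable_funM.
pose nu := mscale (NngNum (ltW c0))
  (measure_function_pushforward__canonical__measure_function_Measure lam mc).
transitivity (\int[nu]_x F x)%E.
  by rewrite ge0_integral_mscale//= ge0_integral_pushforward.
by apply: eq_measure_integral => A mA _; exact: lebesgue_measureM.
Qed.

Lemma integral_itv_scale a b c F : 0 < c -> measurable_fun setT F ->
  (forall x, (0 <= F x)%E) ->
  (\int[lam]_(x in `[a, b[) F (c * x)%R =
   c^-1%:E * \int[lam]_(x in `[(c * a)%R, (c * b)%R[) F x)%E.
Proof.
move=> c0 mF F0; rewrite !integral_itv_if -[in RHS](@ge0_integral_scale c) //.
- rewrite muleA -EFinM mulVf ?gt_eqF// mul1e.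
  by apply: eq_integral => x _ /=; rewrite ler_pM2l// ltr_pM2l.
- exact: measurable_if_itv.
- by move=> x; case: ifP.
Qed.

Lemma integral_invsqr (K l a b : R) : a <= b -> b < l ->
  (\int[lam]_(x in `[a, b]) (K / (l - x) ^+ 2)%:E = (K / (l - b) - K / (l - a))%:E)%E.
Proof.
rewrite le_eqVlt => /predU1P[->|ab] bl.
  by rewrite set_itv1 integral_set1 subrr.
have l0 x : x <= b -> l - x != 0.
  by move=> xb; rewrite gt_eqF// subr_gt0 (le_lt_trans xb).
have dF x : x <= b -> is_derive x (1 : R) (fun x => K / (l - x)) (K / (l - x) ^+ 2).
  move=> xb; have lx := l0 _ xb.
  have dl : is_derive x (1 : R) (fun x : R => l - x) (- 1).
    by apply: is_derive_eq; rewrite add0r mul1r.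
  have dV : is_derive x (1 : R) (fun x : R => (l - x)^-1) ((l - x) ^- 2).
    split; first exact: derivableV.
    by rewrite deriveV// derive_val /GRing.scale/= mulrN1 opprK.
  by apply: is_derive_eq; rewrite /GRing.scale/=; ring.
have cF x : x <= b -> {for x, continuous (fun x => K / (l - x))}.
  by move=> /dF [? _]; apply: differentiable_continuous; apply/derivable1_diffP.
rewrite EFinB.
apply: (@continuous_FTC2 _ (fun x => K / (l - x) ^+ 2) (fun x => K / (l - x))) => //.
- apply: continuous_in_subspaceT => x; rewrite inE/= in_itv/= => /andP[_ xb].
  have lx := l0 _ xb.
  have cl : (fun y : R => l - y) @ x --> l - x by apply: cvgB; [exact: cvg_cst|exact: cvg_id].
  apply: (@cvgM _ _ _ _ (cst K) (fun y => ((l - y) ^+ 2)^-1)); first exact: cvg_cst.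
  apply: cvgV; first by rewrite expf_neq0.
  by rewrite expr2; exact: cvgM.
- split.
  + by move=> x; rewrite in_itv/= => /andP[_ /ltW/dF[]].
  + by apply: cvg_at_right_filter; exact/cF/ltW.
  + by apply: cvg_at_left_filter; exact/cF.
- move=> x; rewrite in_itv/= => /andP[_ /ltW/dF D].
  by rewrite derive1E derive_val.
Qed.

Lemma integral_itv_oc_if a b (F : R -> \bar R) :
  (\int[lam]_(x in `]a, b]) F x = \int[lam]_x (if (a < x <= b)%R then F x else 0))%E.
Proof.
rewrite integral_mkcond; apply: eq_integral => x _; rewrite patchE.
by congr (if _ then _ else _); apply/idP/idP; rewrite inE/= in_itv.
Qed.

End lebesgue_invariance.

(** * Probabilities given by a density *)

Section density_probability.
Context d (T : measurableType d) (R : realType).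
Variables (m : {measure set T -> \bar R}) (q : T -> \bar R).
Hypotheses (mq : measurable_fun setT q) (q0 : forall x, (0 <= q x)%E).
Hypothesis q1 : (\int[m]_x q x = 1)%E.

(** The three facts about [q] are arguments of the term, so that its structure of probability can be
    inferred from the term alone. *)
Definition density_prob of measurable_fun setT q & (forall x, (0 <= q x)%E)
  & (\int[m]_x q x = 1)%E : set T -> \bar R := fun A => (\int[m]_(x in A) q x)%E.

Local Notation P := (density_prob mq q0 q1).

Let P0 : P set0 = 0%E.
Proof. exact: integral_set0. Qed.

Let P_ge0 A : (0 <= P A)%E.
Proof. by apply: integral_ge0. Qed.

Let P_sigma : semi_sigma_additive P.
Proof.
move=> F mF tF mUF; rewrite /density_prob; apply: cvg_toP.
  apply: ereal_nondecreasing_is_cvgn => n k nk.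
  by apply: lee_sum_nneg_natr => // i _ _; exact: integral_ge0.
by rewrite ge0_integral_bigcup//; exact: measurable_funTS.
Qed.

HB.instance Definition _ := isMeasure.Build _ _ _ P P0 P_ge0 P_sigma.

HB.instance Definition _ := @Measure_isProbability.Build _ _ R P q1.

Lemma density_probE (A : set T) : measurable A ->
  P A = (\int[m]_x (q x * (\1_A x)%:E))%E.
Proof.
move=> mA; rewrite /density_prob integral_mkcond; apply: eq_integral => x _.
by rewrite patchE indicE; case: ifP; rewrite ?mule1 ?mule0.
Qed.

End density_probability.

Lemma uniform_prob01E (R : realType) (B : set R) : measurable B ->
  (uniform_prob (@ltr01 R) B = \int[lam]_(x in `[0%R, 1%R[) (\1_B x)%:E)%E.
Proof.
move=> mB; rewrite /uniform_prob integral_itv_bndo_bndc; last first.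
  by apply/measurable_funTS/measurable_EFinP; exact: measurable_indic.
rewrite [LHS]integral_mkcond [RHS]integral_mkcond; apply: eq_integral => x _.
rewrite !patchE indicE /uniform_pdf subr0 invr1.
have -> : (x \in `[0%R, 1%R]%classic) = (0 <= x <= 1).
  by apply/idP/idP; rewrite inE/= in_itv.
by case: ifP; case: ifP.
Qed.

(** On an atom A, the function [phi] takes only the values 0 and P A. It jumps at [x0], so A has no
    more mass than the event that [X] falls in a short interval around [x0], and a uniform [X] makes
    this arbitrarily small. *)
Lemma atomless_uniform (R : realType) d (T : measurableType d) (P : probability T R)
    (X : {RV P >-> R}) :
  has_law P X (uniform_prob (@ltr01 R)) -> atomless P.
Proof.
move=> lX A mA PA0; apply: contrapT => noB.
have mX (B : set R) : measurable B -> measurable (X @^-1` B).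
  by move=> mB; rewrite -[_ @^-1` _]setTI; exact: measurable_funP.
have fA : P A \is a fin_num by exact: fin_num_measure.
pose phi x := P (A `&` X @^-1` `]-oo, x]).
have mphi x : measurable (A `&` X @^-1` `]-oo, x]) by apply: measurableI => //; exact: mX.
have lawX (B : set R) : measurable B -> P (X @^-1` B) = uniform_prob (@ltr01 R) B.
  by move=> mB; rewrite -lX.
have phi01 x : phi x = 0%E \/ phi x = P A.
  have [|n0] := eqVneq (phi x) 0%E; [by left|right].
  have phiA : (phi x <= P A)%E by apply: le_measure; rewrite ?inE//; exact: subIsetl.
  apply/eqP; rewrite eq_le phiA/=.
  rewrite leNgt; apply/negP => lt; apply: noB; exists (A `&` X @^-1` `]-oo, x]).
  by split=> //; rewrite lt andbT lt0e n0 measure_ge0.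
have phi_nd x y : x <= y -> (phi x <= phi y)%E.
  move=> xy; apply: le_measure; rewrite ?inE//.
  by apply: setIS => z /=; rewrite !in_itv/= => /le_trans; apply.
pose S := [set x | phi x = 0%E].
have Sm1 : S (-1).
  apply/eqP; rewrite eq_le measure_ge0 andbT.
  apply: (@le_trans _ _ (P (X @^-1` `]-oo, (-1)%R]))).
    by apply: le_measure; rewrite ?inE//; exact: mX.
  rewrite lawX// /uniform_prob integral_uniform_pdf.
  rewrite (_ : _ `&` _ = set0) ?integral_set0//.
  apply/seteqP; split => z //= []; rewrite !in_itv/= => z1 /andP[z0 _].
  by have := le_trans z0 z1; rewrite oppr_ge0 ler10.
have S1 : ubound S 1.
  move=> x Sx; rewrite leNgt; apply/negP => x1.
  have : phi 1%R = 0%E by apply/eqP; rewrite eq_le measure_ge0 andbT -Sx phi_nd// ltW.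
  move=> phi10; have: (P A <= phi 1%R + P (X @^-1` `]1%R, +oo[))%E.
    apply: (@le_trans _ _ (P ((A `&` X @^-1` `]-oo, 1%R]) `|` X @^-1` `]1%R, +oo[))).
      apply: le_measure; rewrite ?inE//; first by apply: measurableU => //; exact: mX.
      move=> z Az; have [zl|zg] := leP (X z) 1; [left|right] => /=.
        by split => //=; rewrite in_itv.
      by rewrite in_itv/= zg.
    by apply: measureU2 => //; exact: mX.
  rewrite phi10 add0e lawX// /uniform_prob integral_uniform_pdf.
  rewrite (_ : _ `&` _ = set0) ?integral_set0//; first by rewrite leNgt PA0.
  apply/seteqP; split => z //= []; rewrite !in_itv/= andbT => z1 /andP[_ z0].
  by have := lt_le_trans z1 z0; rewrite ltxx.
have hS : has_sup S by split; [exists (-1)|exists 1].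
pose x0 := sup S.
(* The interval ]x0 - e, x0 + e] then has length P A / 2, less than P A. *)
pose e := fine (P A) / 4.
have e0 : 0 < e by rewrite divr_gt0// fine_gt0// PA0 ltey_eq fA.
have [s Ss xs] := sup_adherent e0 hS.
have lo : phi (x0 - e) = 0%E.
  by apply/eqP; rewrite eq_le measure_ge0 andbT -[leRHS]Ss phi_nd// ltW.
have hi : phi (x0 + e) = P A.
  case: (phi01 (x0 + e)) => // S'; have := sup_ubound hS.2 S'.
  by rewrite gerDl leNgt e0.
have : (P A <= P (X @^-1` `](x0 - e)%R, (x0 + e)%R]))%E.
  rewrite -hi -[leRHS]add0e -[X in (_ <= X + _)%E]lo.
  apply: (@le_trans _ _ (P ((A `&` X @^-1` `]-oo, (x0 - e)%R]) `|` X @^-1` `](x0 - e)%R, (x0 + e)%R]))).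
    apply: le_measure; rewrite ?inE//; first by apply: measurableU => //; exact: mX.
    move=> z [Az]; rewrite /= !in_itv/= => zu; have [zl|zg] := leP (X z) (x0 - e).
      by left.
    by right; rewrite zu.
  by apply: measureU2 => //; exact: mX.
rewrite lawX// /uniform_prob leNgt => /negP; apply.
apply: (@le_lt_trans _ _ (\int[lam]_(x in `](x0 - e)%R, (x0 + e)%R]) 1)%E).
  apply: ge0_le_integral => //.
  - by move=> x _; rewrite lee_fin uniform_pdf_ge0.
  - by apply/measurable_EFinP/measurable_funTS; exact: measurable_uniform_pdf.
  - by move=> x _; rewrite lee_fin /uniform_pdf subr0 invr1; case: ifP.
rewrite integral_cst//= mul1e lebesgue_measure_itv/= lte_fin ifT; last by lra.
by rewrite -(fineK fA) -EFinB lte_fin; move: e0; rewrite /e; lra.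
Qed.

(** Layer cake: [phi x] is the length of the set of t with 0 <= t < phi x. Exchanging the integrals
    leaves, for each t, the measure of a set, to which the definition of a density applies. *)
Lemma ge0_integral_density (R : realType) (F : probability (measurableTypeR R) R)
    (f phi : R -> R) : is_density F f -> measurable_fun setT phi ->
  (forall x, 0 <= phi x) ->
  (\int[F]_x (phi x)%:E = \int[lam]_x (f x * phi x)%:E)%E.
Proof.
move=> [mf f0 fF] mphi phi0.
pose H (z : measurableTypeR R * measurableTypeR R) : \bar R := if 0 <= z.2 < phi z.1 then 1%:E else 0%:E.
have mH : measurable_fun setT H.
  apply: measurable_if_itv => //=; exact: measurableT_comp mphi measurable_fst.
have H0 z : (0 <= H z)%E by rewrite /H; case: ifP.
have HE x : (\int[lam]_t H (x, t) = (phi x)%:E)%E.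
  by rewrite -(integral_itv_if 0 (phi x) (cst 1%:E)) integral_itv_cst// subr0 mule1.
transitivity (\int[F]_x \int[lam]_t H (x, t))%E.
  by apply: eq_integral => x _; rewrite HE.
rewrite (@fubini_tonelli _ _ _ _ R F lam H mH H0).
transitivity (\int[lam]_t \int[lam]_x ((f x)%:E * H (x, t)))%E.
  apply: eq_integral => t _.
  have mt : measurable [set x | 0 <= t < phi x].
    rewrite (_ : [set _ | _] = (fun x => 0 <= t < phi x) @^-1` [set true])//.
    rewrite -[X in measurable X]setTI.
    have : measurable_fun setT (fun x => 0 <= t < phi x).
      by apply: measurable_and => //; exact: measurable_fun_ltr.
    by apply.
  transitivity (\int[F]_x (\1_[set x | 0 <= t < phi x] x)%:E)%E.
    apply: eq_integral => x _; rewrite /H indicE/=.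
    by case: ifP => h; [rewrite mem_set|rewrite memNset//= h].
  transitivity (\int[lam]_(x in [set x | (0 <= t < phi x)%R]) (f x)%:E)%E.
    by rewrite integral_indic// setIT; exact: fF.
  rewrite integral_mkcond.
  apply: eq_integral => x _; rewrite patchE /H /=.
  case: ifPn; rewrite ?inE ?notin_setE/= => h; first by rewrite h mule1.
  by rewrite (negbTE (introN idP h)) mule0.
rewrite -(@fubini_tonelli _ _ _ _ R lam lam (fun z => ((f z.1)%:E * H z)%E)) //=; last 2 first.
- apply: emeasurable_funM => //.
  by apply/measurable_EFinP; exact: measurableT_comp mf measurable_fst.
- by move=> z; rewrite mule_ge0// lee_fin.
apply: eq_integral => x _; rewrite ge0_integralZl//; last by rewrite lee_fin.
  by rewrite HE EFinM.
exact: measurableT_comp mH (measurable_pair1 _).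
Qed.

(** * Reflected rotations of an interval *)

Section reflected_rotation.
Context (R : realType).
Implicit Types (G : R -> \bar R) (l h t x : R).

(** Translation by [t] on the circle made from [-l, l[. A single wrap is provided for, which is
    enough for 0 <= t <= l. *)
Definition rotate l t x := if x + t < l then x + t else x + t - 2 * l.

Lemma measurable_rotate d (T : measurableType d) (l t x : T -> R) :
  measurable_fun setT l -> measurable_fun setT t -> measurable_fun setT x ->
  measurable_fun setT (fun z => rotate (l z) (t z) (x z)).
Proof.
move=> ml mt mx; rewrite /rotate.
have mxt : measurable_fun setT (fun z => x z + t z) by exact: measurable_funD.
apply: measurable_fun_ifT; [exact: measurable_fun_ltr|exact: mxt|].
by apply: measurable_funB => //; exact: measurable_funM.
Qed.

Lemma integral_itv_sym l G : 0 <= l -> measurable_fun setT G -> (forall x, (0 <= G x)%E) ->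
  (\int[lam]_(x in `[(- l)%R, l[) G x =
   \int[lam]_(x in `[0%R, l[) G x + \int[lam]_(x in `[0%R, l[) G (- x)%R)%E.
Proof.
move=> l0 mG G0; rewrite (integral_itv_split (c := 0)) ?oppr_le0//.
by rewrite addeC integral_itv_opp// oppr0.
Qed.

Lemma integral_norm l G : 0 <= l -> measurable_fun setT G -> (forall x, (0 <= G x)%E) ->
  (\int[lam]_(x in `[(- l)%R, l[) G `|x|%R = 2%:E * \int[lam]_(x in `[0%R, l[) G x)%E.
Proof.
move=> l0 mG G0; rewrite integral_itv_sym//; last exact: measurableT_comp.
rewrite mule_natl mule2n; congr (_ + _)%E; apply: eq_integral_itv => x /andP[x0 _].
  by rewrite ger0_norm.
by rewrite normrN ger0_norm.
Qed.

Lemma integral_rotate l t G : 0 <= t -> t <= l -> measurable_fun setT G ->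
  (forall x, (0 <= G x)%E) ->
  (\int[lam]_(x in `[(- l)%R, l[) G (rotate l t x) = \int[lam]_(x in `[(- l)%R, l[) G x)%E.
Proof.
move=> t0 tl mG G0.
have mw : measurable_fun setT (fun x => G (rotate l t x)).
  by apply: measurableT_comp => //; exact: measurable_rotate.
rewrite (@integral_itv_split _ _ _ (l - t)) //; [|lra..].
rewrite (@eq_integral_itv _ (- l) (l - t) _ (fun x => G (x + t))); last first.
  by move=> x /andP[_ xl]; rewrite /rotate ifT//; lra.
rewrite (@eq_integral_itv _ (l - t) l _ (fun x => G (x + (t - 2 * l)))); last first.
  by move=> x /andP[xl _]; rewrite /rotate ifF ?addrA//; apply/negbTE; rewrite -leNgt; lra.
rewrite !integral_itv_shift// addeC.
rewrite [RHS](@integral_itv_split _ _ _ (- l + t)) //; [|lra..].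
rewrite (_ : (l - t + (t - 2 * l))%R = - l); last by ring.
rewrite (_ : (l + (t - 2 * l))%R = - l + t); last by ring.
by rewrite subrK.
Qed.

(** The difference is constant, equal to t on [-l, -t[ and to -t on [0, l - t[. On [-t, 0[ and on [l
    - t, l[ it is affine with slope -2 and 2 respectively, and each time sweeps the interval between
    -t and t; the two factors 1/2 add up to 1. *)
Lemma integral_rotate_sub l t G : 0 <= t -> t <= l -> measurable_fun setT G ->
  (forall x, (0 <= G x)%E) ->
  (\int[lam]_(x in `[(- l)%R, l[) G (`|x| - `|rotate l t x|)%R =
   (l - t)%:E * (G t + G (- t)%R) + \int[lam]_(x in `[(- t)%R, t[) G x)%E.
Proof.
move=> t0 tl mG G0.
have mw : measurable_fun setT (fun x => G (`|x| - `|rotate l t x|)).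
  apply: measurableT_comp => //; apply: measurable_funB => //; apply: measurableT_comp => //.
  exact: measurable_rotate.
have two0 : 0 < 2 :> R by [].
rewrite (@integral_itv_split _ _ _ (- t)) //; [|lra..].
rewrite (@integral_itv_split _ (- t) _ 0) //; [|lra..].
rewrite (@integral_itv_split _ 0 _ (l - t)) //; [|lra..].
rewrite (@eq_integral_itv _ (- l) (- t) _ (fun x => G t)); last first.
  move=> x /andP[xl xt]; rewrite /rotate ifT; last by lra.
  by rewrite !ltr0_norm; [congr G; lra|lra..].
rewrite (@eq_integral_itv _ 0 (l - t) _ (fun x => G (- t))); last first.
  move=> x /andP[xl xt]; rewrite /rotate ifT; last by lra.
  by rewrite !ger0_norm; [congr G; lra|lra..].
rewrite (@eq_integral_itv _ (- t) 0 _ (fun x => (fun y => G (- (y + t))) (2 * x))); last first.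
  move=> x /andP[xl xt]; rewrite /rotate ifT; last by lra.
  by rewrite ltr0_norm// ger0_norm; [congr G; lra|lra..].
rewrite (@eq_integral_itv _ (l - t) l _ (fun x => (fun y => G (y + (t - 2 * l))) (2 * x))); last first.
  move=> x /andP[xl xt]; rewrite /rotate ifF; last by apply/negbTE; rewrite -leNgt; lra.
  by rewrite ger0_norm ?ltr0_norm; [congr G; lra|lra..].
have mo : measurable_fun setT (fun y : R => G (- y)) by exact: measurableT_comp.
have ms s : measurable_fun setT (fun y : R => G (y + s)).
  by apply: measurableT_comp => //; exact: measurable_funD.
rewrite (@integral_itv_scale _ (- t) 0 2 (fun y => G (- (y + t))))//; last first.
  by apply: (measurableT_comp mo); exact: measurable_funD.
rewrite (@integral_itv_scale _ (l - t) l 2 (fun y => G (y + (t - 2 * l))))//.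
rewrite (@integral_itv_shift _ _ _ t (fun y => G (- y)))// integral_itv_shift// integral_itv_opp//.
rewrite !integral_itv_cst; [|lra..].
rewrite (_ : (- (2 * 0 + t))%R = - t); last by ring.
rewrite (_ : (- (2 * - t + t))%R = t); last by ring.
rewrite (_ : (2 * (l - t) + (t - 2 * l))%R = - t); last by ring.
rewrite (_ : (2 * l + (t - 2 * l))%R = t); last by ring.
set I := (\int[_]_(x in _) _)%E.
rewrite (_ : - t - - l = l - t); last by ring.
rewrite (_ : l - t - 0 = l - t); last by ring.
have I0 : (0 <= I)%E by exact: integral_ge0.
clearbody I; rewrite ge0_muleDr// -addeA; congr (_ + _)%E.
rewrite addeCA; congr (_ + _)%E.
by rewrite -ge0_muleDl ?lee_fin ?invr_ge0// -EFinD (_ : (2^-1 + 2^-1)%R = 1) ?mul1e//; field.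
Qed.

End reflected_rotation.

Section rotation_angle.
Context (R : realType).
Implicit Types (G : R -> \bar R) (l h t x : R).

(* The only density nu on ]0, h] with (l - t) nu(t) + int_t^h nu = l / h for all
   t, which is what makes the difference in integral_angle_pdf_rotate_sub
   uniform. *)
Definition angle_pdf h l t : R :=
  if 0 < t <= h then l * (l - h) / h / (l - t) ^+ 2 else 0.

Lemma angle_pdf_ge0 h l t : 0 < h -> h < l -> 0 <= angle_pdf h l t.
Proof.
move=> h0 hl; rewrite /angle_pdf; case: ifP => // _.
rewrite divr_ge0 ?sqr_ge0// divr_ge0 ?(ltW h0)// mulr_ge0//; lra.
Qed.

Lemma measurable_angle_pdf d (T : measurableType d) h (l t : T -> R) :
  measurable_fun setT l -> measurable_fun setT t ->
  measurable_fun setT (fun z => angle_pdf h (l z) (t z)).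
Proof.
move=> ml mt; apply: measurable_fun_ifT => //.
  by apply: measurable_and; [exact: measurable_fun_ltr|exact: measurable_fun_ler].
apply: measurable_funM; last first.
  by apply: measurable_funV; apply: measurable_funX; exact: measurable_funB.
apply: measurable_funM => //; apply: measurable_funM => //; exact: measurable_funB.
Qed.

Lemma integral_angle_pdf_tail h l t : 0 < h -> h < l -> 0 <= t <= h ->
  (\int[lam]_(x in `]t, h]) (l * (l - h) / h / (l - x) ^+ 2)%:E =
   (l / h - l * (l - h) / h / (l - t))%:E)%E.
Proof.
move=> h0 hl /andP[t0 th]; rewrite integral_itv_obnd_cbnd; last first.
  apply/measurable_EFinP; apply: measurable_funTS; apply: measurable_funM => //.
  by apply: measurable_funV; apply: measurable_funX; exact: measurable_funB.
rewrite integral_invsqr//; congr EFin.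
field; rewrite !gt_eqF// subr_gt0//; exact: le_lt_trans hl.
Qed.

Lemma integral_angle_pdf h l : 0 < h -> h < l ->
  (\int[lam]_t (angle_pdf h l t)%:E = 1)%E.
Proof.
move=> h0 hl.
transitivity (\int[lam]_(x in `]0%R, h]) (l * (l - h) / h / (l - x) ^+ 2)%:E)%E.
  rewrite integral_itv_oc_if; apply: eq_integral => t _.
  by rewrite /angle_pdf; case: ifP.
rewrite integral_angle_pdf_tail ?lexx ?(ltW h0)//; congr EFin.
by field; rewrite !gt_eqF// (lt_trans h0).
Qed.

(** After folding [G] to [S x = G x + G (- x)] and exchanging integrals, the coefficient of [S x]
    for 0 <= x < h has two parts: C / (l - x) from the constant pieces, and the tail of [angle_pdf]
    beyond x, which is l / h - C / (l - x), from the sweeps. Their sum does not depend on x. [X1]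
    and [X2] are these two parts. *)
Lemma integral_angle_pdf_rotate_sub h l G : 0 < h -> h < l -> measurable_fun setT G ->
  (forall x, (0 <= G x)%E) ->
  (\int[lam]_t ((angle_pdf h l t)%:E *
     ((l - t)%:E * (G t + G (- t)%R) + \int[lam]_(x in `[(- t)%R, t[) G x)) =
   (l / h)%:E * \int[lam]_(x in `[(- h)%R, h[) G x)%E.
Proof.
move=> h0 hl mG G0; pose S x := (G x + G (- x)%R)%E.
have l0 : 0 < l by exact: lt_trans hl.
have mGo : measurable_fun setT (fun x : R => G (- x)) by exact: measurableT_comp.
have mS : measurable_fun setT S by exact: emeasurable_funD.
have S0 x : (0 <= S x)%E by exact: adde_ge0.
have GS t : 0 <= t -> (\int[lam]_(x in `[(- t)%R, t[) G x = \int[lam]_(x in `[0%R, t[) S x)%E.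
  by move=> t0; rewrite integral_itv_sym// ge0_integralD//; exact: measurable_funTS.
pose C := l * (l - h) / h.
have C0 : 0 <= C by rewrite divr_ge0 ?(ltW h0)// mulr_ge0//; lra.
pose X1 x := ((C / (l - x))%:E * S x)%E.
pose X2 x := ((l / h - C / (l - x))%:E * S x)%E.
have mC : measurable_fun setT (fun x => C / (l - x)).
  by apply: measurable_funM => //; apply: measurable_funV; exact: measurable_funB.
have mX1 : measurable_fun setT X1.
  by apply: emeasurable_funM => //; exact/measurable_EFinP.
have mX2 : measurable_fun setT X2.
  by apply: emeasurable_funM => //; apply/measurable_EFinP; exact: measurable_funB.
have X1_ge0 x : 0 <= x < h -> (0 <= X1 x)%E.
  move=> /andP[_ xh]; rewrite mule_ge0// lee_fin divr_ge0//; lra.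
have X2_ge0 x : 0 <= x < h -> (0 <= X2 x)%E.
  move=> /andP[x0 xh]; rewrite mule_ge0// lee_fin subr_ge0 /C.
  rewrite ler_pdivrMr; last by lra.
  rewrite mulrAC ler_pM2l ?divr_gt0//; lra.
pose nS t := (if (0 < t <= h)%R then X1 t else 0)%E.
(* The constraint 0 <= x < t is put into the integrand as a function of the pair (t, x), so that
   Tonelli's theorem applies on the whole plane. *)
pose K (z : measurableTypeR R * measurableTypeR R) : \bar R :=
  ((angle_pdf h l z.1)%:E * (if (0 <= z.2 < z.1)%R then S z.2 else 0))%E.
have mK : measurable_fun setT K.
  apply: emeasurable_funM.
    by apply/measurable_EFinP; exact: measurable_angle_pdf.
  by apply: measurable_if_itv => //; exact: measurableT_comp mS measurable_snd.
have K0 z : (0 <= K z)%E.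
  by rewrite mule_ge0 ?lee_fin ?angle_pdf_ge0//; case: ifP.
transitivity (\int[lam]_t (nS t + \int[lam]_x K (t, x)))%E.
  apply: eq_integral => t _.
  have -> : (\int[lam]_x K (t, x) =
      (angle_pdf h l t)%:E * \int[lam]_(x in `[0%R, t[) S x)%E.
    rewrite integral_itv_if -ge0_integralZl//.
    - by apply: measurable_if_itv.
    - by move=> x _; case: ifP.
    - by rewrite lee_fin angle_pdf_ge0.
  rewrite /nS /X1 /angle_pdf; case: ifP => [/andP[t0 th]|]; last by rewrite !mul0e adde0.
  rewrite GS ?(ltW t0)//.
  have I0 : (0 <= \int[lam]_(x in `[0%R, t[) S x)%E by exact: integral_ge0.
  move: (integral _ _ _) I0 => I I0.
  have A0 : (0 <= (l - t)%:E * S t)%E by rewrite mule_ge0// lee_fin; lra.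
  rewrite (ge0_muleDr _ A0 I0).
  congr (_ + _)%E; rewrite muleA -EFinM; congr (EFin _ * _)%E.
  have lt0 : l - t != 0 by rewrite gt_eqF//; lra.
  by rewrite /C; field; rewrite ?lt0 ?gt_eqF.
have mnS : measurable_fun setT nS.
  apply: measurable_fun_ifT => //.
  by apply: measurable_and; [exact: measurable_fun_ltr|exact: measurable_fun_ler].
have nS0 x : (0 <= nS x)%E.
  rewrite /nS; case: ifP => // /andP[x0 xh]; rewrite mule_ge0// lee_fin divr_ge0//; lra.
rewrite ge0_integralD//; last 2 first.
- by move=> t _; exact: integral_ge0.
- exact: measurable_fun_fubini_tonelli_F.
rewrite (@fubini_tonelli _ _ _ _ R lam lam K)//.
have -> : (\int[lam]_x nS x = \int[lam]_(x in `[0%R, h[) X1 x)%E.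
  by rewrite -integral_itv_oc_co// integral_itv_oc_if.
have -> : (\int[lam]_x \int[lam]_t K (t, x) = \int[lam]_(x in `[0%R, h[) X2 x)%E.
  rewrite integral_itv_if; apply: eq_integral => x _.
  case: ifPn => [/andP[x0 xh]|xh].
    rewrite /X2 -integral_angle_pdf_tail ?x0 ?(ltW xh)// integral_itv_oc_if.
    rewrite muleC -ge0_integralZl//.
    - apply: eq_integral => t _; rewrite /K/= /angle_pdf x0/=.
      case: (ltP x t) => xt /=; last by rewrite !mule0.
      by rewrite (le_lt_trans x0 xt)/= muleC; case: ifP.
    - apply: measurable_fun_ifT => //.
        by apply: measurable_and; [exact: measurable_fun_ltr|exact: measurable_fun_ler].
      apply/measurable_EFinP; apply: measurable_funM => //.
      by apply: measurable_funV; apply: measurable_funX; exact: measurable_funB.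
    - move=> t _; case: ifP => // _; rewrite lee_fin divr_ge0 ?sqr_ge0//.
  rewrite integral0_eq// => t _; rewrite /K/= /angle_pdf.
  case: ifP => [/andP[t0 th]|]; last by rewrite mul0e.
  case: ifP => [/andP[x0 xt]|]; last by rewrite mule0.
  by move: xh; rewrite x0/= (lt_le_trans xt th).
rewrite -ge0_integralD//; [|exact: measurable_funTS..].
rewrite GS ?(ltW h0)// -ge0_integralZl//; last 2 first.
- exact: measurable_funTS.
- by rewrite lee_fin divr_ge0// ltW.
apply: eq_integral_itv => x /andP[x0 xh].
rewrite /X1 /X2 -ge0_muleDl ?lee_fin; last 2 first.
- rewrite divr_ge0//; lra.
- rewrite subr_ge0 /C ler_pdivrMr; last by lra.
  rewrite mulrAC ler_pM2l ?divr_gt0//; lra.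
by rewrite -EFinD addrC subrK.
Qed.

End rotation_angle.

(** * Rotations of tiles *)

Section tiling.
Context (R : realType).
Implicit Types (G : R -> \bar R) (u v l x : R) (n : nat).

(** Rotation by [u] modulo [u + v] on each of the consecutive tiles of length [u + v] that start at
    [l]. The floor is the index of the tile containing [x], and the tested quantity is the position
    of [x] inside that tile. *)
Definition tile_shift u v l x :=
  if x - l - (Num.floor ((x - l) / (u + v)))%:~R * (u + v) < v then x + u else x - v.

Lemma measurable_tile_shift d (T : measurableType d) (u v l x : T -> R) :
  measurable_fun setT u -> measurable_fun setT v ->
  measurable_fun setT l -> measurable_fun setT x ->
  measurable_fun setT (fun z => tile_shift (u z) (v z) (l z) (x z)).
Proof.
move=> mu mv ml mx.
have muv : measurable_fun setT (fun z => u z + v z) by exact: measurable_funD.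
have mxl : measurable_fun setT (fun z => x z - l z) by exact: measurable_funB.
apply: measurable_fun_ifT; [|exact: measurable_funD|exact: measurable_funB].
apply: measurable_fun_ltr => //; apply: measurable_funB => //; apply: measurable_funM => //.
by apply: measurable_fun_floor; apply: measurable_funM => //; exact: measurable_funV.
Qed.

Lemma tile_shiftE u v l n x : 0 < u + v ->
  l + n%:R * (u + v) <= x < l + n.+1%:R * (u + v) ->
  tile_shift u v l x = if x < l + n%:R * (u + v) + v then x + u else x - v.
Proof.
move=> uv0 /andP[xl xu]; rewrite /tile_shift.
have -> : Num.floor ((x - l) / (u + v)) = n%:Z.
  apply/Num.Theory.floor_def; rewrite ler_pdivlMr// ltr_pdivrMr//.
  by move: xu; rewrite intrD -!pmulrn -natr1 => xu; apply/andP; split; lra.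
by congr (if _ then _ else _); rewrite -pmulrn; apply/idP/idP; lra.
Qed.

Section block.
Variables (u v l : R) (n : nat).
Hypotheses (u0 : 0 < u) (v0 : 0 < v).
Let c := l + n%:R * (u + v).
Let uv0 : 0 < u + v := addr_gt0 u0 v0.

Lemma integral_block (H : R -> R -> \bar R) :
  measurable_fun setT (fun x => H x (tile_shift u v l x)) ->
  (forall x y, (0 <= H x y)%E) ->
  (\int[lam]_(x in `[c, (c + (u + v))%R[) H x (tile_shift u v l x) =
   \int[lam]_(x in `[c, (c + v)%R[) H x (x + u)%R +
   \int[lam]_(x in `[(c + v)%R, (c + (u + v))%R[) H x (x - v)%R)%E.
Proof.
move=> mH H0; rewrite (@integral_itv_split _ _ _ (c + v))//; last 2 first.
- by rewrite lerDl ltW.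
- by rewrite lerD2l lerDr ltW.
have E x : c <= x < c + (u + v) -> tile_shift u v l x = if x < c + v then x + u else x - v.
  by move=> cx; rewrite (@tile_shiftE _ _ _ n)// -natr1 mulrDl mul1r addrA.
congr (_ + _)%E; apply: eq_integral_itv => x /andP[x1 x2]; congr H; rewrite E.
- by rewrite x2.
- by rewrite x1 (lt_le_trans x2)// lerD2l lerDr ltW.
- by rewrite ltNge x1.
- by rewrite x2 (le_trans _ x1)// lerDl ltW.
Qed.

End block.

(** An interval exchange: in each tile the first part, of length v, moves to the end and the last
    part, of length u, moves to the front. *)
Lemma integral_tile_shift u v l n G : 0 < u -> 0 < v -> measurable_fun setT G ->
  (forall x, (0 <= G x)%E) ->
  (\int[lam]_(x in `[l, (l + n%:R * (u + v))%R[) G (tile_shift u v l x) =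
   \int[lam]_(x in `[l, (l + n%:R * (u + v))%R[) G x)%E.
Proof.
move=> u0 v0 mG G0; have uv0 := addr_gt0 u0 v0.
have mt : measurable_fun setT (fun x => G (tile_shift u v l x)).
  by apply: measurableT_comp => //; exact: measurable_tile_shift.
elim: n => [|n IHn]; first by rewrite mul0r addr0 !set_itvco0 !integral_set0.
have nn : 0 <= n%:R * (u + v) by rewrite mulr_ge0// ltW.
rewrite -natr1 mulrDl mul1r addrA.
set c := l + n%:R * (u + v).
rewrite (@integral_itv_split _ l _ c)//; [|rewrite /c; lra..].
rewrite IHn -/c (@integral_block u v l n u0 v0 (fun _ y => G y))// -/c.
rewrite integral_itv_shift// integral_itv_shift// addrK.
rewrite [RHS](@integral_itv_split _ l _ c)//; [|rewrite /c; lra..].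
congr (_ + _)%E; rewrite addeC [RHS](@integral_itv_split _ _ _ (c + u))//; [|lra..].
have cE : c + (u + v) = c + u + v by ring.
by rewrite cE addrK (addrAC c v u).
Qed.

Lemma integral_tile_shift_sub u v l n G : 0 < u -> 0 < v -> measurable_fun setT G ->
  (forall x, (0 <= G x)%E) ->
  (\int[lam]_(x in `[l, (l + n%:R * (u + v))%R[) G (x - tile_shift u v l x)%R =
   n%:R%:E * (v%:E * G (- u)%R + u%:E * G v))%E.
Proof.
move=> u0 v0 mG G0; have uv0 := addr_gt0 u0 v0.
have mt : measurable_fun setT (fun x => G (x - tile_shift u v l x)).
  apply: measurableT_comp => //; apply: measurable_funB => //.
  exact: measurable_tile_shift.
elim: n => [|n IHn]; first by rewrite mul0r addr0 !set_itvco0 !integral_set0 mul0e.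
have nn : 0 <= n%:R * (u + v) by rewrite mulr_ge0// ltW.
rewrite -natr1 mulrDl mul1r addrA.
set c := l + n%:R * (u + v).
rewrite (@integral_itv_split _ l _ c)//; [|rewrite /c; lra..].
rewrite IHn (@integral_block u v l n u0 v0 (fun x y => G (x - y)))// -/c.
rewrite (@eq_integral_itv _ c (c + v) _ (fun=> G (- u))); last first.
  by move=> x _; congr G; ring.
rewrite (@eq_integral_itv _ (c + v) (c + (u + v)) _ (fun=> G v)); last first.
  by move=> x _; congr G; ring.
rewrite !integral_itv_cst; [|lra..].
rewrite (_ : c + v - c = v); last by ring.
rewrite (_ : c + (u + v) - (c + v) = u); last by ring.
have W0 : (0 <= v%:E * G (- u)%R + u%:E * G v)%E.
  by rewrite adde_ge0// mule_ge0// lee_fin ltW.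
by rewrite EFinD ge0_muleDl ?lee_fin// mul1e.
Qed.

End tiling.

(** * Coupling attached to a pair (u, v) *)

Section share.
Context (R : realType).
Implicit Types (G A B : R -> \bar R) (u v l h t x : R).

(* ceil ((1 - h) / (u + v)) - 1, i.e. the largest n with n (u + v) < 1 - h *)
Definition tiles h u v : R := - (Num.floor (- ((1 - h) / (u + v))))%:~R - 1.

Lemma measurable_tiles d (T : measurableType d) h (u v : T -> R) :
  measurable_fun setT u -> measurable_fun setT v ->
  measurable_fun setT (fun z => tiles h (u z) (v z)).
Proof.
move=> mu mv; apply: measurable_funB => //.
apply: measurableT_comp => //; apply: measurable_fun_floor.
apply: measurableT_comp => //; apply: measurable_funM => //.
by apply: measurable_funV; exact: measurable_funD.
Qed.

Lemma tilesP h u v : h < 1 -> 0 < u + v -> exists n : nat,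
  [/\ tiles h u v = n%:R, n%:R * (u + v) < 1 - h & 1 - h <= n.+1%:R * (u + v)].
Proof.
move=> h1 uv0; rewrite /tiles; set y := (1 - h) / (u + v).
have y0 : 0 < y by rewrite divr_gt0// subr_gt0.
have /andP[f1 f2] := Num.Theory.floor_itv (- y).
have fl0 : (Num.floor (- y) < 0)%R.
  by rewrite -(ltr_int R) (le_lt_trans f1)// oppr_lt0.
(* A negative floor is [Negz n], that is -(n + 1), so that [tiles] is [n]. The floor is taken of
   [- y] to get n < y strictly, hence an uncovered length strictly above [h]. *)
case: (Num.floor (- y)) fl0 f1 f2 => // n _ f1 f2.
exists n; move: f1 f2; rewrite NegzE intrD !mulrNz -pmulrn -natr1 => f1 f2.
have yE : y * (u + v) = 1 - h by rewrite /y divfK// gt_eqF.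
split; first lra.
- by rewrite -yE ltr_pM2r//; lra.
- by rewrite -yE ler_pM2r//; lra.
Qed.

(* The points of [-l, l[ are folded onto [0, l[, hence the weight 1/2. *)
Definition share_weight l x : R :=
  if -l <= x < l then 2^-1 else if l <= x < 1 then 1 else 0.

Lemma share_weight_ge0 l x : 0 <= share_weight l x.
Proof. by rewrite /share_weight; case: ifP => // _; case: ifP. Qed.

Lemma measurable_share_weight d (T : measurableType d) (l x : T -> R) :
  measurable_fun setT l -> measurable_fun setT x ->
  measurable_fun setT (fun z => share_weight (l z) (x z)).
Proof.
move=> ml mx; apply: measurable_fun_ifT => //.
  apply: measurable_and; last exact: measurable_fun_ltr.
  by apply: measurable_fun_ler => //; exact: measurableT_comp.
apply: measurable_fun_ifT => //.
by apply: measurable_and; [exact: measurable_fun_ler|exact: measurable_fun_ltr].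
Qed.

Lemma integral_share_weight l A B :
  measurable_fun setT A -> (forall x, (0 <= A x)%E) ->
  measurable_fun setT B -> (forall x, (0 <= B x)%E) ->
  (\int[lam]_x ((share_weight l x)%:E * (if (x < l)%R then A x else B x)) =
   (2^-1)%:E * \int[lam]_(x in `[(- l)%R, l[) A x + \int[lam]_(x in `[l, 1%R[) B x)%E.
Proof.
move=> mA A0 mB B0; rewrite !integral_itv_if -ge0_integralZl//; last 2 first.
- exact: measurable_if_itv.
- by move=> x _; case: ifP.
rewrite -ge0_integralD//; last 4 first.
- by move=> x _; case: ifP => _; rewrite ?mule0// mule_ge0// lee_fin.
- by apply: emeasurable_funM => //; exact: measurable_if_itv.
- by move=> x _; case: ifP.
- exact: measurable_if_itv.
apply: eq_integral => x _; rewrite /share_weight.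
case: (ltP x l) => xl; rewrite ?andbT ?andbF/=.
  by rewrite adde0; case: ifP => _; rewrite ?mul0e ?mule0.
by rewrite mule0 add0e; case: ifP => _; rewrite ?mul0e ?mul1e.
Qed.

(** On [l, 1[ the absolute value is the identity, so the same formula serves the folded circle and
    the tiles. *)
Definition share_X x := `|x|.

Definition share_Y u v l t x := if x < l then `|rotate l t x| else tile_shift u v l x.

Lemma measurable_share_Y d (T : measurableType d) (u v l t x : T -> R) :
  measurable_fun setT u -> measurable_fun setT v -> measurable_fun setT l ->
  measurable_fun setT t -> measurable_fun setT x ->
  measurable_fun setT (fun z => share_Y (u z) (v z) (l z) (t z) (x z)).
Proof.
move=> mu mv ml mt mx; apply: measurable_fun_ifT; first exact: measurable_fun_ltr.
  by apply: measurableT_comp => //; exact: measurable_rotate.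
exact: measurable_tile_shift.
Qed.

Section fixed_share.
Variables (h u v : R) (n : nat).
Hypotheses (h0 : 0 < h) (u0 : 0 < u) (v0 : 0 < v) (hn : n%:R * (u + v) < 1 - h).
Let l := 1 - n%:R * (u + v).

Let hl : h < l. Proof. by rewrite /l; move: hn; lra. Qed.
Let l0 : 0 < l. Proof. exact: lt_trans hl. Qed.
Let l1 : l <= 1.
Proof. by rewrite /l gerBl mulr_ge0// ltW// addr_gt0. Qed.
Let lE : l + n%:R * (u + v) = 1. Proof. by rewrite /l subrK. Qed.

Let integral_angle (H : R -> R -> \bar R) (r : \bar R) : (0 <= r)%E ->
  (forall t, (0 < t <= h)%R ->
    \int[lam]_x ((share_weight l x)%:E * H t x) = r)%E ->
  (forall t x, (0 <= H t x)%E) -> (forall t, measurable_fun setT (H t)) ->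
  (\int[lam]_t \int[lam]_x
     ((angle_pdf h l t * share_weight l x)%:E * H t x) = r)%E.
Proof.
move=> r0 Hr H0 mH.
transitivity (\int[lam]_t ((angle_pdf h l t)%:E * r))%E.
  apply: eq_integral => t _.
  transitivity ((angle_pdf h l t)%:E * \int[lam]_x ((share_weight l x)%:E * H t x))%E.
    rewrite -ge0_integralZl//.
    - by apply: eq_integral => x _; rewrite EFinM muleA.
    - apply: emeasurable_funM; last exact: mH.
      by apply/measurable_EFinP; exact: measurable_share_weight.
    - by move=> x _; rewrite mule_ge0// lee_fin share_weight_ge0.
    - by rewrite lee_fin angle_pdf_ge0.
  have [th|th] := boolP (0 < t <= h); first by rewrite (Hr t th).
  by rewrite /angle_pdf (negbTE th) !mul0e.
rewrite ge0_integralZr//.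
- by rewrite integral_angle_pdf// mul1e.
- by apply/measurable_EFinP; exact: measurable_angle_pdf.
- by move=> t _; rewrite lee_fin angle_pdf_ge0.
Qed.

Let half_two (r : \bar R) : ((2^-1)%:E * (2%:E * r) = r)%E.
Proof. by rewrite muleA -EFinM mulVf// mul1e. Qed.

Lemma integral_share_X G : measurable_fun setT G -> (forall x, (0 <= G x)%E) ->
  (\int[lam]_t \int[lam]_x
     ((angle_pdf h l t * share_weight l x)%:E * G (share_X x)) =
   \int[lam]_(x in `[0%R, 1%R[) G x)%E.
Proof.
move=> mG G0; apply: (@integral_angle (fun _ x => G `|x|)) => //.
- exact: integral_ge0.
- move=> t _; rewrite -[RHS](_ : ((2^-1)%:E * \int[lam]_(x in `[(- l)%R, l[) G `|x|%R +
      \int[lam]_(x in `[l, 1%R[) G x)%E = _); last first.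
    rewrite integral_norm//; last exact: ltW.
    by rewrite half_two -integral_itv_split// ltW.
  rewrite -integral_share_weight//; last exact: measurableT_comp.
  apply: eq_integral => x _; congr (_ * _)%E; case: ltP => // xl.
  by rewrite ger0_norm// (le_trans _ xl)// ltW.
- by move=> _; exact: measurableT_comp.
Qed.

(** For each fixed t, the rotation preserves Lebesgue measure on the circle, whose folding covers
    [0, l[ twice with weight 1/2, and the tile rotations preserve it on [l, 1[. Averaging over t
    changes nothing. *)
Lemma integral_share_Y G : measurable_fun setT G -> (forall x, (0 <= G x)%E) ->
  (\int[lam]_t \int[lam]_x
     ((angle_pdf h l t * share_weight l x)%:E * G (share_Y u v l t x)) =
   \int[lam]_(x in `[0%R, 1%R[) G x)%E.
Proof.
move=> mG G0; apply: (@integral_angle (fun t x => G (share_Y u v l t x))) => //.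
- exact: integral_ge0.
- move=> t /andP[t0 th].
  have mGn : measurable_fun setT (fun x : R => G `|x|) by exact: measurableT_comp.
  rewrite -[RHS](_ : ((2^-1)%:E * \int[lam]_(x in `[(- l)%R, l[) G `|rotate l t x|%R +
      \int[lam]_(x in `[l, 1%R[) G (tile_shift u v l x))%E = _); last first.
    rewrite (@integral_rotate _ l t (fun x => G `|x|))//; [|exact: ltW|exact: (le_trans th (ltW hl))].
    rewrite integral_norm//; last exact: ltW.
    by rewrite half_two -[in `[l, 1[]lE integral_tile_shift// lE -integral_itv_split// ltW.
  rewrite -integral_share_weight//.
  + by apply: eq_integral => x _; congr (_ * _)%E; rewrite /share_Y; case: ifP.
  + by apply: (measurableT_comp mGn); exact: measurable_rotate.
  + by apply: measurableT_comp => //; exact: measurable_tile_shift.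
- by move=> t; apply: measurableT_comp => //; exact: measurable_share_Y.
Qed.

(** The folded circle contributes half of the value l / h found for the unfolded one. The tiles
    contribute a term [W] free of t, which averages to itself because [angle_pdf] has mass one. *)
Lemma integral_share_sub G : measurable_fun setT G -> (forall x, (0 <= G x)%E) ->
  (\int[lam]_t \int[lam]_x
     ((angle_pdf h l t * share_weight l x)%:E * G (share_X x - share_Y u v l t x)%R) =
   (l / (2 * h))%:E * \int[lam]_(x in `[(- h)%R, h[) G x +
   n%:R%:E * (v%:E * G (- u)%R + u%:E * G v))%E.
Proof.
move=> mG G0.
pose W := (n%:R%:E * (v%:E * G (- u)%R + u%:E * G v))%E.
have W0 : (0 <= W)%E.
  by rewrite mule_ge0 ?lee_fin// adde_ge0// mule_ge0// lee_fin ltW.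
pose V t := ((l - t)%:E * (G t + G (- t)%R) + \int[lam]_(x in `[(- t)%R, t[) G x)%E.
have mrotate t : measurable_fun setT (fun x => `|x| - `|rotate l t x|).
  by apply: measurable_funB => //; apply: measurableT_comp => //; exact: measurable_rotate.
have mtile : measurable_fun setT (fun x => x - tile_shift u v l x).
  by apply: measurable_funB => //; exact: measurable_tile_shift.
pose K (z : measurableTypeR R * measurableTypeR R) : \bar R :=
  if - z.1 <= z.2 < z.1 then G z.2 else 0%E.
have mK : measurable_fun setT K.
  apply: measurable_if_itv => //; first exact: measurableT_comp mG measurable_snd.
  exact: measurableT_comp.
have mV : measurable_fun setT V.
  apply: emeasurable_funD.
    apply: emeasurable_funM; first by apply/measurable_EFinP; exact: measurable_funB.
    by apply: emeasurable_funD => //; exact: measurableT_comp.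
  rewrite (_ : (fun t => _) = fubini_F lam K).
    apply: measurable_fun_fubini_tonelli_F => // z.
    by rewrite /K; case: ifP.
  by apply/funext => t; rewrite integral_itv_if.
(* Nonnegativity is claimed only on the support of [angle_pdf], since the factor l - t is negative
   for t > l. *)
have V0 t : 0 < t <= h -> (0 <= V t)%E.
  move=> /andP[t0 th]; rewrite adde_ge0 ?integral_ge0// mule_ge0 ?adde_ge0// lee_fin.
  by rewrite subr_ge0 (le_trans th)// ltW.
transitivity (\int[lam]_t ((2^-1)%:E * ((angle_pdf h l t)%:E * V t) + (angle_pdf h l t)%:E * W))%E.
  apply: eq_integral => t _.
  transitivity ((angle_pdf h l t)%:E * \int[lam]_x ((share_weight l x)%:E *
      G (share_X x - share_Y u v l t x)%R))%E.
    have mGs : measurable_fun setT (fun x => G (share_X x - share_Y u v l t x)).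
      apply: measurableT_comp => //; apply: measurable_funB => //.
      exact: measurable_share_Y.
    rewrite -ge0_integralZl//.
    - by apply: eq_integral => x _; rewrite EFinM muleA.
    - apply: emeasurable_funM => //.
      by apply/measurable_EFinP; exact: measurable_share_weight.
    - by move=> x _; rewrite mule_ge0// lee_fin share_weight_ge0.
    - by rewrite lee_fin angle_pdf_ge0.
  have [th|th] := boolP (0 < t <= h); last by rewrite /angle_pdf (negbTE th) !mul0e mule0 adde0.
  have tl : t <= l by case/andP: th => _ /le_trans; apply; exact: ltW.
  have t0 : 0 <= t by case/andP: th => /ltW.
  rewrite muleCA -ge0_muleDr//; last by rewrite mule_ge0 ?lee_fin// V0.
  congr (_ * _)%E.
  rewrite /V /W -integral_rotate_sub// -(@integral_tile_shift_sub _ _ _ l)// lE.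
  rewrite -integral_share_weight//.
  - apply: eq_integral => x _; congr (_ * _)%E; rewrite /share_X /share_Y.
    by case: ltP => // lx; rewrite (@ger0_norm _ x)// (le_trans _ lx)// ltW.
  - exact: measurableT_comp.
  - exact: measurableT_comp.
rewrite ge0_integralD//=; last 4 first.
- move=> t _; rewrite /angle_pdf; case: ifPn => th; last by rewrite mul0e mule0.
  by rewrite mule_ge0 ?lee_fin// mule_ge0 ?V0//; have := angle_pdf_ge0 t h0 hl; rewrite /angle_pdf th lee_fin.
- apply: emeasurable_funM => //; apply: emeasurable_funM => //.
  by apply/measurable_EFinP; exact: measurable_angle_pdf.
- by move=> t _; rewrite mule_ge0// lee_fin angle_pdf_ge0.
- apply: emeasurable_funM => //.
  by apply/measurable_EFinP; exact: measurable_angle_pdf.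
congr (_ + _)%E; last first.
  rewrite ge0_integralZr//.
  - by rewrite integral_angle_pdf// mul1e.
  - by apply/measurable_EFinP; exact: measurable_angle_pdf.
  - by move=> t _; rewrite lee_fin angle_pdf_ge0.
rewrite ge0_integralZl//; last 2 first.
- apply: emeasurable_funM => //.
  by apply/measurable_EFinP; exact: measurable_angle_pdf.
- move=> t _; rewrite /angle_pdf; case: ifPn => th; last by rewrite mul0e.
  by rewrite mule_ge0 ?V0//; have := angle_pdf_ge0 t h0 hl; rewrite /angle_pdf th lee_fin.
rewrite integral_angle_pdf_rotate_sub// muleA -EFinM; congr (_%:E * _)%E.
by field; rewrite gt_eqF.
Qed.

End fixed_share.
End share.

(** * Mixture of the couplings *)

Section sigma_finite_product.
Context d1 d2 (T1 : measurableType d1) (T2 : measurableType d2) (R : realType).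
Variables (m1 : {sigma_finite_measure set T1 -> \bar R})
  (m2 : {sigma_finite_measure set T2 -> \bar R}).

(* An alias, because no sigma-finite structure is inferred for [m1 \x m2] when
   [m1] and [m2] are only sigma-finite. *)
Definition sigma_finite_product : set (T1 * T2) -> \bar R := (m1 \x m2)%E.

HB.instance Definition _ := Measure.on sigma_finite_product.

Let sigma_finite_productT : sigma_finite setT sigma_finite_product.
Proof.
have /sigma_finiteP[A [AT A_nd Aoo]] := sigma_finiteT m1.
have /sigma_finiteP[B [BT B_nd Boo]] := sigma_finiteT m2.
exists (fun n => A n `*` B n).
  apply/esym/seteqP; split => // -[x y] _.
  have [i _ Ax] : (\bigcup_n A n) x by rewrite -AT.
  have [j _ By] : (\bigcup_n B n) y by rewrite -BT.
  exists (maxn i j) => //; split.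
    by apply: (subsetPset _ _ (A_nd _ _ (leq_maxl i j))).
  by apply: (subsetPset _ _ (B_nd _ _ (leq_maxr i j))).
move=> n; have [mA Afin] := Aoo n; have [mB Bfin] := Boo n.
split; first exact: measurableX.
by rewrite [ltLHS]product_measure1E// lte_mul_pinfty// ge0_fin_numE.
Qed.

HB.instance Definition _ := Measure_isSigmaFinite.Build _ _ _
  sigma_finite_product sigma_finite_productT.

Lemma integral_product_measure (f : T1 * T2 -> \bar R) :
  measurable_fun setT f -> (forall p, (0 <= f p)%E) ->
  (\int[sigma_finite_product]_p f p = \int[m1]_x \int[m2]_y f (x, y))%E.
Proof. exact: fubini_tonelli1. Qed.

End sigma_finite_product.

Section assembly.
Context (R : realType).
Local Notation mR := (measurableTypeR R).
Local Notation lam := (@lebesgue_measure R).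
Implicit Types (G : R -> \bar R) (u v : R).

Definition lam2 := sigma_finite_product lam lam.

Lemma integral_lam2 (f : mR * mR -> \bar R) : measurable_fun setT f ->
  (forall p, (0 <= f p)%E) ->
  (\int[lam2]_p f p = \int[lam]_x \int[lam]_y f (x, y))%E.
Proof. exact: integral_product_measure. Qed.

Lemma integral_prod (phi psi : R -> \bar R) :
  measurable_fun setT phi -> measurable_fun setT psi ->
  (forall x, (0 <= phi x)%E) -> (forall x, (0 <= psi x)%E) ->
  (\int[lam2]_p (phi p.1 * psi p.2) = \int[lam]_x phi x * \int[lam]_x psi x)%E.
Proof.
move=> mphi mpsi phi0 psi0; rewrite integral_lam2//=; last 2 first.
- apply: emeasurable_funM; first exact: measurableT_comp mphi measurable_fst.
  exact: measurableT_comp mpsi measurable_snd.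
- by move=> x; exact: mule_ge0.
rewrite -ge0_integralZr//; last exact: integral_ge0.
by apply: eq_integral => x _; rewrite ge0_integralZl.
Qed.

Definition pos_part (g : R -> R) v := if 0 < v then g v else 0.

Lemma integral_pos_parts (g : R -> R) G : measurable_fun setT g -> (forall x, 0 <= g x) ->
  measurable_fun setT G -> (forall x, (0 <= G x)%E) ->
  (\int[lam]_x ((pos_part (fun u => g (- u)%R) x)%:E * G (- x)%R) +
   \int[lam]_x ((pos_part g x)%:E * G x) = \int[lam]_x ((g x)%:E * G x))%E.
Proof.
move=> mg g0 mG G0.
pose H x := ((g x)%:E * G x)%E.
have mH : measurable_fun setT H by apply: emeasurable_funM => //; exact/measurable_EFinP.
have H0 x : (0 <= H x)%E by rewrite mule_ge0// lee_fin.
have mP : measurable_fun setT (fun x : R => if 0 < x then H x else 0%E).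
  by apply: measurable_fun_ifT => //; exact: measurable_fun_ltr.
have mN : measurable_fun setT (fun x : R => if x < 0 then H x else 0%E).
  by apply: measurable_fun_ifT => //; exact: measurable_fun_ltr.
transitivity (\int[lam]_x (if (x < 0)%R then H x else 0) +
              \int[lam]_x (if (0 < x)%R then H x else 0))%E.
  congr (_ + _)%E.
    rewrite -[RHS]ge0_integral_opp//; last by move=> x; case: ifP.
    apply: eq_integral => x _; rewrite /pos_part oppr_lt0.
    by case: ifP => // _; rewrite mul0e.
  by apply: eq_integral => x _; rewrite /pos_part; case: ifP => // _; rewrite mul0e.
rewrite -ge0_integralD//; last 2 first.
- by move=> x _; case: ifP.
- by move=> x _; case: ifP.
have -> : (\int[lam]_x ((g x)%:E * G x) = \int[lam]_(x in ~` [set 0%R]) H x)%E.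
  by rewrite -setTD integral_setD1//; [exact: measurableD|exact: measurable_funTS].
rewrite [RHS]integral_mkcond; apply: eq_integral => x _; rewrite patchE.
have -> : (x \in ~` [set 0%R]) = (x != 0).
  by apply/idP/idP; rewrite inE/= => /eqP.
by case: ltgtP => [x0|x0|->]; rewrite ?adde0 ?add0e.
Qed.

(** * The density of the shares over the pairs (u, v) *)

Variables (g : R -> R) (h b kappa m : R).
Hypotheses (mg : measurable_fun setT g) (g0 : forall x, 0 <= g x).
Hypotheses (h0 : 0 < h) (hb1 : h + b < 1) (b0 : 0 < b).
Hypothesis gsupp : forall u v, 0 < u -> 0 < v -> g (- u) != 0 -> g v != 0 -> u + v <= b.
Hypotheses (kappa0 : 0 < kappa).
Let gm := pos_part (fun u => g (- u)).
Let gp := pos_part g.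
Hypothesis kappam : (\int[lam]_x (x * gm x)%:E = kappa%:E)%E.
Hypothesis kappap : (\int[lam]_x (x * gp x)%:E = kappa%:E)%E.
Hypothesis gmass : (\int[lam]_x (g x)%:E = (1 - m)%:E)%E.
Hypothesis hbm : h + b <= m.

Let h1 : h < 1. Proof. by move: hb1 b0; lra. Qed.

Let mgm : measurable_fun setT gm.
Proof.
apply: measurable_fun_ifT => //; first exact: measurable_fun_ltr.
exact: measurableT_comp.
Qed.
Let mgp : measurable_fun setT gp.
Proof. by apply: measurable_fun_ifT => //; exact: measurable_fun_ltr. Qed.
Let gm0 x : 0 <= gm x. Proof. by rewrite /gm /pos_part; case: ifP. Qed.
Let gp0 x : 0 <= gp x. Proof. by rewrite /gp /pos_part; case: ifP. Qed.

(** The mixture density (u + v) g(-u) g(v) / kappa divided by the length n (u + v) that a share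
    spends on its two-point law. The divisor is positive wherever the numerator is nonzero, because
    at least one tile fits there. *)
Definition pair_pdf (p : mR * mR) : R :=
  gm p.1 * gp p.2 / (kappa * tiles h p.1 p.2).

Let a1 := pair_pdf.

Let gmgp u v : gm u * gp v != 0 -> [/\ 0 < u, 0 < v & u + v <= b].
Proof.
rewrite mulf_eq0 negb_or /gm /gp /pos_part => /andP[].
case: ifP => [u0 gu|]; last by rewrite eqxx.
by case: ifP => [v0 gv|]; [split=> //; exact: gsupp|rewrite eqxx].
Qed.

(** Without any tile, 1 - h <= u + v <= b would contradict h + b < 1. As one more tile would not
    fit, the covered length exceeds or equals 1 - h - (u + v), hence 1 - h - b. *)
Let tiles_gt0 u v : 0 < u -> 0 < v -> u + v <= b ->
  exists n : nat, [/\ tiles h u v = n%:R, (0 < n)%N & 1 - h - b <= n%:R * (u + v)].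
Proof.
move=> u0 v0 uvb; have uv0 := addr_gt0 u0 v0.
have [n [tE _ hn]] := tilesP h1 uv0.
exists n; split=> //.
  rewrite lt0n; apply/eqP => n0; move: hn; rewrite n0 mul1r.
  by move: hb1; lra.
by move: hn; rewrite -natr1 mulrDl mul1r; lra.
Qed.

Let ma1 : measurable_fun setT a1.
Proof.
apply: measurable_funM.
  apply: measurable_funM; first exact: measurableT_comp mgm measurable_fst.
  exact: measurableT_comp mgp measurable_snd.
by apply: measurable_funV; apply: measurable_funM => //; exact: measurable_tiles.
Qed.

Let a1_ge0 p : 0 <= a1 p.
Proof.
rewrite /a1 /pair_pdf; have [->|/gmgp[u0 v0 uvb]] := eqVneq (gm p.1 * gp p.2) 0.
  by rewrite mul0r.
have [n [-> n0 _]] := tiles_gt0 u0 v0 uvb.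
by rewrite divr_ge0 ?mulr_ge0 ?(ltW kappa0).
Qed.

Let mtiles : measurable_fun setT (fun p : mR * mR => tiles h p.1 p.2).
Proof. exact: measurable_tiles. Qed.

Let a1_tiles p : a1 p * tiles h p.1 p.2 = gm p.1 * gp p.2 / kappa.
Proof.
rewrite /a1 /pair_pdf; have [->|/gmgp[u0 v0 uvb]] := eqVneq (gm p.1 * gp p.2) 0.
  by rewrite !mul0r.
have [n [-> n0 _]] := tiles_gt0 u0 v0 uvb.
have n0' : n%:R != 0 :> R by rewrite pnatr_eq0 -lt0n.
by field; rewrite n0' gt_eqF.
Qed.

(** Integrating v out of v g(-u) g(v) G(-u) leaves kappa g(-u) G(-u), and integrating u out of the
    other term leaves kappa g(v) G(v). Equality of the two moments, that is mean zero, lets the same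
    kappa cancel in both; the two half-lines fill the line up to a null point. *)
Lemma integral_pair_pdf_tiles G : measurable_fun setT G -> (forall x, (0 <= G x)%E) ->
  (\int[lam2]_p ((pair_pdf p * tiles h p.1 p.2)%:E *
      (p.2%:E * G (- p.1)%R + p.1%:E * G p.2)) = \int[lam]_x ((g x)%:E * G x))%E.
Proof.
move=> mG G0.
pose A1 x := ((gm x)%:E * G (- x)%R)%E.
pose A2 x := ((gp x)%:E * G x)%E.
pose B1 x := (x * gm x)%:E.
pose B2 x := (x * gp x)%:E.
have mA1 : measurable_fun setT A1.
  by apply: emeasurable_funM; [exact/measurable_EFinP|exact: measurableT_comp].
have mA2 : measurable_fun setT A2 by apply: emeasurable_funM => //; exact/measurable_EFinP.
have mB1 : measurable_fun setT B1 by apply/measurable_EFinP; exact: measurable_funM.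
have mB2 : measurable_fun setT B2 by apply/measurable_EFinP; exact: measurable_funM.
have A10 x : (0 <= A1 x)%E by rewrite mule_ge0// lee_fin.
have A20 x : (0 <= A2 x)%E by rewrite mule_ge0// lee_fin.
have B10 x : (0 <= B1 x)%E.
  rewrite lee_fin /gm /pos_part; case: ifP => [x0|]; last by rewrite mulr0.
  by rewrite mulr_ge0// ltW.
have B20 x : (0 <= B2 x)%E.
  rewrite lee_fin /gp /pos_part; case: ifP => [x0|]; last by rewrite mulr0.
  by rewrite mulr_ge0// ltW.
transitivity (\int[lam2]_p (kappa^-1%:E * (A1 p.1 * B2 p.2 + B1 p.1 * A2 p.2)))%E.
  apply: eq_integral => p _; rewrite [pair_pdf p * _]a1_tiles /A1 /A2 /B1 /B2.
  have [/eqP|/gmgp[u0 v0 _]] := eqVneq (gm p.1 * gp p.2) 0.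
    by rewrite mulf_eq0 => /orP[] /eqP ->; rewrite !(mul0r,mulr0,mul0e,mule0,adde0,add0e).
  have u0' := ltW u0; have v0' := ltW v0.
  rewrite [X in (_ = _ * (X + _))%E]muleAC [X in (_ = _ * (_ + X))%E]muleA -!EFinM.
  rewrite (_ : gm p.1 * (p.2 * gp p.2) = gm p.1 * gp p.2 * p.2); last by ring.
  rewrite (_ : p.1 * gm p.1 * gp p.2 = gm p.1 * gp p.2 * p.1); last by ring.
  rewrite [(_ * p.2)%:E]EFinM [(_ * p.1)%:E]EFinM -![in RHS]muleA -ge0_muleDr; last 2 first.
  - by rewrite mule_ge0// lee_fin.
  - by rewrite mule_ge0// lee_fin.
  by rewrite muleA -EFinM mulrC.
have mAB : measurable_fun setT (fun p : mR * mR => (A1 p.1 * B2 p.2)%E).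
  apply: emeasurable_funM; first exact: measurableT_comp mA1 measurable_fst.
  exact: measurableT_comp mB2 measurable_snd.
have mBA : measurable_fun setT (fun p : mR * mR => (B1 p.1 * A2 p.2)%E).
  apply: emeasurable_funM; first exact: measurableT_comp mB1 measurable_fst.
  exact: measurableT_comp mA2 measurable_snd.
rewrite ge0_integralZl//; last 3 first.
- exact: emeasurable_funD.
- by move=> p _; rewrite adde_ge0// mule_ge0.
- by rewrite lee_fin invr_ge0 ltW.
rewrite ge0_integralD//; last 2 first.
- by move=> p _; rewrite mule_ge0.
- by move=> p _; rewrite mule_ge0.
rewrite !integral_prod// kappam kappap -integral_pos_parts// [X in (_ + X)%E]muleC.
rewrite -ge0_muleDl; last 2 first.
- exact: integral_ge0.
- exact: integral_ge0.
by rewrite muleCA -EFinM mulVf ?mule1// gt_eqF.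
Qed.

Let tiles_sum p : a1 p * tiles h p.1 p.2 * (p.1 + p.2) =
  (gm p.1 * gp p.2) * (p.1 + p.2) / kappa.
Proof. by rewrite a1_tiles; ring. Qed.

Let covered_ge0 p : 0 <= a1 p * tiles h p.1 p.2 * (p.1 + p.2).
Proof.
rewrite tiles_sum; have [->|/gmgp[u0 v0 _]] := eqVneq (gm p.1 * gp p.2) 0.
  by rewrite !mul0r.
by rewrite divr_ge0 ?(ltW kappa0)// !mulr_ge0// addr_ge0// ltW.
Qed.

Let integral_covered :
  (\int[lam2]_p (a1 p * tiles h p.1 p.2 * (p.1 + p.2))%:E = (1 - m)%:E)%E.
Proof.
rewrite -gmass; have := @integral_pair_pdf_tiles (cst 1%E).
rewrite /= => H; transitivity (\int[lam]_x ((g x)%:E * 1))%E; last first.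
  by apply: eq_integral => x _; rewrite mule1.
rewrite -H//; apply: eq_integral => p _.
by rewrite !mule1 -EFinD -EFinM [p.2 + p.1]addrC.
Qed.

(** A pair covers at least 1 - h - b of its share, so the total share times 1 - h - b is at most the
    covered length 1 - m, and [hbm] concludes. *)
Let integral_a1_le1 : (\int[lam2]_p (a1 p)%:E <= 1)%E.
Proof.
have s0 : 0 < 1 - h - b by move: hb1; lra.
apply: (@le_trans _ _ (\int[lam2]_p
    ((1 - h - b)^-1%:E * (a1 p * tiles h p.1 p.2 * (p.1 + p.2))%:E))%E).
  apply: ge0_le_integral => //.
  - by move=> p _; rewrite lee_fin.
  - exact/measurable_EFinP.
  - apply: emeasurable_funM => //; apply/measurable_EFinP.
    apply: measurable_funM; first exact: measurable_funM.
    exact: measurable_funD.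
  - move=> p _; rewrite -EFinM lee_fin ler_pdivlMl//.
    have [E0|/gmgp[u0 v0 uvb]] := eqVneq (gm p.1 * gp p.2) 0.
      by rewrite /a1 /pair_pdf -/gm -/gp E0 !mul0r mulr0.
    have [n [tE n0 hn]] := tiles_gt0 u0 v0 uvb.
    by rewrite tE -mulrA mulrC ler_wpM2l.
rewrite ge0_integralZl//; last 3 first.
- apply/measurable_EFinP; apply: measurable_funM; first exact: measurable_funM.
  exact: measurable_funD.
- by move=> p _; rewrite lee_fin.
- by rewrite lee_fin invr_ge0 ltW.
rewrite [X in (_ * X)%E]integral_covered -EFinM lee_fin ler_pdivrMl// mulr1.
by move: hbm; lra.
Qed.

Let A := fine (\int[lam2]_p (a1 p)%:E).

Let AE : (\int[lam2]_p (a1 p)%:E = A%:E)%E.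
Proof.
rewrite /A fineK// ge0_fin_numE; first exact: le_lt_trans integral_a1_le1 (ltry _).
by apply: integral_ge0 => p _; rewrite lee_fin.
Qed.

Let A1 : A <= 1. Proof. by rewrite -lee_fin -AE. Qed.

(** * Completion of the shares to total mass one *)

Let unit12 (x : R) : R := if 1 <= x < 2 then 1 else 0.

Let munit12 : measurable_fun setT unit12.
Proof.
apply: measurable_fun_ifT => //.
by apply: measurable_and; [exact: measurable_fun_ler|exact: measurable_fun_ltr].
Qed.

Let unit12_ge0 x : 0 <= unit12 x. Proof. by rewrite /unit12; case: ifP. Qed.

(* The missing mass goes to the box [1, 2[^2, where there is no tile because
   u + v > 1. *)
Definition share_pdf (p : mR * mR) : R := pair_pdf p + (1 - A) * (unit12 p.1 * unit12 p.2).

Let a := share_pdf.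

Let mbox : measurable_fun setT (fun p : mR * mR => unit12 p.1 * unit12 p.2).
Proof.
apply: measurable_funM; first exact: measurableT_comp munit12 measurable_fst.
exact: measurableT_comp munit12 measurable_snd.
Qed.

Let ma : measurable_fun setT a.
Proof. by apply: measurable_funD => //; exact: measurable_funM. Qed.

Let box_ge0 p : 0 <= (1 - A) * (unit12 p.1 * unit12 p.2).
Proof. by rewrite !mulr_ge0// subr_ge0. Qed.

Let a_ge0 p : 0 <= a p. Proof. by rewrite addr_ge0. Qed.

Let integral_a : (\int[lam2]_p (a p)%:E = 1)%E.
Proof.
transitivity (\int[lam2]_p
    ((a1 p)%:E + (1 - A)%:E * (unit12 p.1 * unit12 p.2)%:E))%E.
  by apply: eq_integral => p _; rewrite -EFinM -EFinD.
rewrite ge0_integralD//; last 4 first.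
- by move=> p _; rewrite lee_fin.
- exact/measurable_EFinP.
- by move=> p _; rewrite -EFinM lee_fin.
- by apply: emeasurable_funM => //; exact/measurable_EFinP.
rewrite [X in (X + _)%E]AE ge0_integralZl//; last 3 first.
- exact/measurable_EFinP.
- by move=> p _; rewrite lee_fin mulr_ge0.
- by rewrite lee_fin subr_ge0.
under eq_integral do rewrite EFinM.
rewrite (@integral_prod (EFin \o unit12) (EFin \o unit12)); last 4 first.
- exact/measurable_EFinP.
- exact/measurable_EFinP.
- by move=> x; rewrite lee_fin.
- by move=> x; rewrite lee_fin.
have -> : (\int[lam]_x (EFin \o unit12) x = 1)%E.
  transitivity (\int[lam]_(x in `[1%R, 2%R[) 1%:E)%E.
    rewrite integral_itv_if; apply: eq_integral => x _.
    by rewrite /unit12/=; case: ifP.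
  by rewrite integral_itv_cst ?ler1n// mule1; congr EFin; ring.
by rewrite !mule1 -EFinD addrC subrK.
Qed.

Let box_supp p : unit12 p.1 * unit12 p.2 != 0 -> [/\ 0 < p.1, 0 < p.2 & tiles h p.1 p.2 = 0].
Proof.
rewrite mulf_eq0 negb_or /unit12 => /andP[].
case: ifP => [/andP[u1 _] _|]; last by rewrite eqxx.
case: ifP => [/andP[v1 _] _|]; last by rewrite eqxx.
have u0 : 0 < p.1 by exact: lt_le_trans u1.
have v0 : 0 < p.2 by exact: lt_le_trans v1.
split=> //; have [[|n] [-> hn _]] := tilesP h1 (addr_gt0 u0 v0); first by [].
have : p.1 + p.2 <= n.+1%:R * (p.1 + p.2) by rewrite ler_peMl ?ler1n// addr_ge0// ltW.
by move: h0; lra.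
Qed.

Let a_supp p : a p != 0 -> 0 < p.1 /\ 0 < p.2.
Proof.
rewrite /a /share_pdf; have [E|/gmgp[u0 v0 _] _] := eqVneq (gm p.1 * gp p.2) 0; last by [].
have [->|/box_supp[u0 v0 _] _] := eqVneq (unit12 p.1 * unit12 p.2) 0; last by [].
by rewrite /pair_pdf -/gm -/gp E mul0r mulr0 addr0 eqxx.
Qed.

Let a_tiles p : a p * tiles h p.1 p.2 = a1 p * tiles h p.1 p.2.
Proof.
rewrite /a /share_pdf mulrDl.
have [->|/box_supp[_ _ ->]] := eqVneq (unit12 p.1 * unit12 p.2) 0.
  by rewrite mulr0 mul0r addr0.
by rewrite !mulr0 addr0.
Qed.

Definition share_len (p : mR * mR) : R := 1 - tiles h p.1 p.2 * (p.1 + p.2).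

Let mlen : measurable_fun setT share_len.
Proof.
apply: measurable_funB => //; apply: measurable_funM => //; exact: measurable_funD.
Qed.

Let a_len_ge0 p : 0 <= a p * share_len p.
Proof.
have [->|/a_supp[u0 v0]] := eqVneq (a p) 0; first by rewrite mul0r.
rewrite mulr_ge0// /share_len; have [n [-> hn _]] := tilesP h1 (addr_gt0 u0 v0).
by move: hn h0; lra.
Qed.

(** Total mass 1 minus the covered length 1 - m. Thus the uniform part receives its correct mass
    without any condition on the individual uncovered lengths. *)
Let integral_a_len : (\int[lam2]_p (a p * share_len p)%:E = m%:E)%E.
Proof.
have mc : measurable_fun setT (fun p : mR * mR => a1 p * tiles h p.1 p.2 * (p.1 + p.2)).
  apply: measurable_funM; first exact: measurable_funM.
  exact: measurable_funD.
have := integral_a.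
have -> : (\int[lam2]_p (a p)%:E = \int[lam2]_p ((a p * share_len p)%:E +
    (a1 p * tiles h p.1 p.2 * (p.1 + p.2))%:E))%E.
  apply: eq_integral => p _; rewrite -EFinD; congr EFin.
  by rewrite -a_tiles /share_len; ring.
rewrite ge0_integralD//; last 4 first.
- by move=> p _; rewrite lee_fin.
- by apply/measurable_EFinP; exact: measurable_funM.
- by move=> p _; rewrite lee_fin.
- exact/measurable_EFinP.
rewrite integral_covered.
set I := (\int[_]_p (_ * share_len _)%:E)%E.
have I0 : (0 <= I)%E by apply: integral_ge0 => p _; rewrite lee_fin.
case: I I0 => [r _|//|//]; rewrite -EFinD => -[rE]; congr EFin.
by move: rE; lra.
Qed.

(** * The coupling density in the variables (u, v, t, x) *)

Let mR4 := ((mR * mR) * (mR * mR))%type.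

Definition lam4 := sigma_finite_product lam2 lam2.

Let kernel (p w : mR * mR) : R :=
  angle_pdf h (share_len p) w.1 * share_weight (share_len p) w.2.

Definition coupling_pdf (z : mR4) : \bar R := (share_pdf z.1 * kernel z.1 z.2)%:E.

(** Outside the support of [share_pdf] the length [share_len p] may fall below [h], where
    [angle_pdf] can be negative. This alternative confines all sign arguments to the support. *)
Let a0_kernel p : a p = 0 \/ (0 < p.1 /\ 0 < p.2 /\ h < share_len p /\
  exists n : nat, [/\ tiles h p.1 p.2 = n%:R & n%:R * (p.1 + p.2) < 1 - h]).
Proof.
have [|/a_supp[u0 v0]] := eqVneq (a p) 0; [by left|right].
have [n [tE hn _]] := tilesP h1 (addr_gt0 u0 v0).
split=> //; split=> //; split; last by exists n.
by rewrite /share_len tE; move: hn; lra.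
Qed.

Let mkernel : measurable_fun setT (fun z : mR4 => kernel z.1 z.2).
Proof.
have ml : measurable_fun setT (fun z : mR4 => share_len z.1).
  exact: measurableT_comp mlen measurable_fst.
apply: measurable_funM.
  by apply: measurable_angle_pdf => //; exact: measurableT_comp measurable_fst measurable_snd.
by apply: measurable_share_weight => //; exact: measurableT_comp measurable_snd measurable_snd.
Qed.

Let mq : measurable_fun setT coupling_pdf.
Proof.
apply/measurable_EFinP; apply: measurable_funM => //.
exact: measurableT_comp ma measurable_fst.
Qed.

Let q0 z : (0 <= coupling_pdf z)%E.
Proof.
rewrite lee_fin; case: (a0_kernel z.1) => [E|[_ [_ [hl _]]]].
  by rewrite [share_pdf _]E mul0r.
by rewrite mulr_ge0 ?mulr_ge0 ?angle_pdf_ge0 ?share_weight_ge0//; exact: a_ge0.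
Qed.

(** Integrates (t, x) out at fixed (u, v). Where [share_pdf] vanishes both sides vanish, so [I] has
    to be correct only for positive u and v. *)
Let integral_coupling (H : mR4 -> \bar R) (I : mR * mR -> \bar R) :
  measurable_fun setT H -> (forall z, (0 <= H z)%E) ->
  (forall p, 0 < p.1 -> 0 < p.2 ->
    (\int[lam]_t \int[lam]_x ((kernel p (t, x))%:E * H (p, (t, x))) = I p)%E) ->
  (\int[lam4]_z (coupling_pdf z * H z) =
   \int[lam2]_p ((share_pdf p)%:E * I p))%E.
Proof.
move=> mH H0 HI.
have mqH : measurable_fun setT (fun z => coupling_pdf z * H z)%E by exact: emeasurable_funM.
have qH0 z : (0 <= coupling_pdf z * H z)%E by rewrite mule_ge0.
transitivity (\int[lam2]_p \int[lam2]_w (coupling_pdf (p, w) * H (p, w)))%E.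
  exact: (integral_product_measure lam2 lam2 mqH qH0).
apply: eq_integral => p _; rewrite /coupling_pdf/=.
have [E|[u0 [v0 [hl _]]]] := a0_kernel p.
  rewrite integral0_eq => [|w _]; first by rewrite [share_pdf p]E mul0e.
  by rewrite [share_pdf p]E mul0r mul0e.
have k0 w : (0 <= (kernel p w)%:E)%E.
  by rewrite lee_fin mulr_ge0 ?angle_pdf_ge0 ?share_weight_ge0.
have mk : measurable_fun setT (fun w => (kernel p w)%:E).
  apply/measurable_EFinP.
  exact: (measurableT_comp mkernel (measurable_pair1 p)).
have mHp : measurable_fun setT (fun w => H (p, w)).
  exact: measurableT_comp mH (measurable_pair1 p).
under eq_integral do rewrite EFinM -muleA.
rewrite ge0_integralZl//; last 3 first.
- exact: emeasurable_funM.
- by move=> w _; rewrite mule_ge0.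
- by rewrite lee_fin a_ge0.
congr (_ * _)%E; rewrite -HI// integral_lam2//.
- exact: emeasurable_funM.
- by move=> w; rewrite mule_ge0.
Qed.

Let integral_coupling_cst (H : mR4 -> \bar R) (r : \bar R) : (0 <= r)%E ->
  measurable_fun setT H -> (forall z, (0 <= H z)%E) ->
  (forall p, 0 < p.1 -> 0 < p.2 ->
    (\int[lam]_t \int[lam]_x ((kernel p (t, x))%:E * H (p, (t, x))) = r)%E) ->
  (\int[lam4]_z (coupling_pdf z * H z) = r)%E.
Proof.
move=> r0 mH H0 Hr; rewrite (@integral_coupling _ (cst r))// ge0_integralZr//.
- by rewrite [X in (X * _)%E]integral_a mul1e.
- exact/measurable_EFinP.
- by move=> p _; rewrite lee_fin a_ge0.
Qed.

Definition coupling_X (z : mR4) : R := share_X z.2.2.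

Definition coupling_Y (z : mR4) : R :=
  share_Y z.1.1 z.1.2 (share_len z.1) z.2.1 z.2.2.

Let mX : measurable_fun setT coupling_X.
Proof.
have m22 : measurable_fun setT (fun z : mR4 => z.2.2).
  exact: measurableT_comp measurable_snd measurable_snd.
exact: (measurableT_comp (@normr_measurable R setT) m22).
Qed.

Let mY : measurable_fun setT coupling_Y.
Proof.
apply: measurable_share_Y.
- exact: measurableT_comp measurable_fst measurable_fst.
- exact: measurableT_comp measurable_snd measurable_fst.
- exact: measurableT_comp mlen measurable_fst.
- exact: measurableT_comp measurable_fst measurable_snd.
- exact: measurableT_comp measurable_snd measurable_snd.
Qed.

Let integral_coupling_X G : measurable_fun setT G -> (forall x, (0 <= G x)%E) ->
  (\int[lam4]_z (coupling_pdf z * G (coupling_X z)) =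
   \int[lam]_(x in `[0%R, 1%R[) G x)%E.
Proof.
move=> mG G0; apply: integral_coupling_cst => //.
- exact: integral_ge0.
- exact: measurableT_comp.
- move=> p u0 v0; have [n [tE hn _]] := tilesP h1 (addr_gt0 u0 v0).
  by rewrite /kernel /share_len tE; exact: integral_share_X.
Qed.

Let integral_coupling_Y G : measurable_fun setT G -> (forall x, (0 <= G x)%E) ->
  (\int[lam4]_z (coupling_pdf z * G (coupling_Y z)) =
   \int[lam]_(x in `[0%R, 1%R[) G x)%E.
Proof.
move=> mG G0; apply: integral_coupling_cst => //.
- exact: integral_ge0.
- exact: measurableT_comp.
- move=> p u0 v0; have [n [tE hn _]] := tilesP h1 (addr_gt0 u0 v0).
  by rewrite /kernel /coupling_Y /share_len tE; exact: integral_share_Y.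
Qed.

(** Given (u, v), the difference has density l / (2h) on [-h, h[ and atoms n v at -u and n u at v.
    The first part averages by [integral_a_len], the atoms by [integral_pair_pdf_tiles]. *)
Let integral_coupling_sub G : measurable_fun setT G -> (forall x, (0 <= G x)%E) ->
  (\int[lam4]_z
      (coupling_pdf z * G (coupling_X z - coupling_Y z)%R) =
   (m / (2 * h))%:E * \int[lam]_(x in `[(- h)%R, h[) G x +
   \int[lam]_x ((g x)%:E * G x))%E.
Proof.
move=> mG G0; pose J := (\int[lam]_(x in `[(- h)%R, h[) G x)%E.
have J0 : (0 <= J)%E by exact: integral_ge0.
pose K (p : mR * mR) := (p.2%:E * G (- p.1)%R + p.1%:E * G p.2)%E.
have mK : measurable_fun setT K.
  apply: emeasurable_funD; apply: emeasurable_funM.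
  - by apply/measurable_EFinP; exact: measurable_snd.
  - by apply: measurableT_comp => //; apply: measurableT_comp => //; exact: measurable_fst.
  - by apply/measurable_EFinP; exact: measurable_fst.
  - by apply: measurableT_comp => //; exact: measurable_snd.
rewrite (@integral_coupling _ (fun p => (share_len p / (2 * h))%:E * J +
    (tiles h p.1 p.2)%:E * K p)%E); last 3 first.
- by apply: measurableT_comp => //; exact: measurable_funB.
- by [].
- move=> p u0 v0; have [n [tE hn _]] := tilesP h1 (addr_gt0 u0 v0).
  by rewrite /kernel /coupling_Y /share_len tE; exact: integral_share_sub.
transitivity (\int[lam2]_p ((share_pdf p * share_len p)%:E * ((2 * h)^-1%:E * J) +
    (pair_pdf p * tiles h p.1 p.2)%:E * K p))%E.
  apply: eq_integral => p _; have := a_tiles p; rewrite /a /a1 => <-.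
  case: (a0_kernel p) => [E|[u0 [v0 [hl [n [tE hn]]]]]].
    by rewrite [share_pdf p]E !mul0r !mul0e adde0.
  have K0 : (0 <= K p)%E by rewrite adde_ge0// mule_ge0// lee_fin ltW.
  rewrite ge0_muleDr; last 2 first.
  - by rewrite mule_ge0// lee_fin divr_ge0 ?mulr_ge0 ?(ltW h0)// (ltW (lt_trans h0 hl)).
  - by rewrite mule_ge0// lee_fin tE.
  by rewrite !muleA -!EFinM mulrA.
rewrite ge0_integralD//; last 4 first.
- move=> p _; rewrite mule_ge0//; first by rewrite lee_fin; exact: a_len_ge0.
  by rewrite mule_ge0// lee_fin invr_ge0 mulr_ge0// ltW.
- by apply: emeasurable_funM => //; apply/measurable_EFinP; exact: measurable_funM.
- move=> p _; have := a_tiles p; rewrite /a /a1 => <-.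
  case: (a0_kernel p) => [E|[u0 [v0 [hl [n [tE hn]]]]]].
    by rewrite [share_pdf p]E !mul0r !mul0e.
  rewrite mule_ge0//; first by rewrite lee_fin tE mulr_ge0//; exact: a_ge0.
  by rewrite adde_ge0// mule_ge0// lee_fin ltW.
- by apply: emeasurable_funM => //; apply/measurable_EFinP; exact: measurable_funM.
rewrite integral_pair_pdf_tiles//; congr (_ + _)%E.
rewrite ge0_integralZr//; last 3 first.
- by apply/measurable_EFinP; exact: measurable_funM.
- by move=> p _; rewrite lee_fin; exact: a_len_ge0.
- by rewrite mule_ge0// lee_fin invr_ge0 mulr_ge0// ltW.
by rewrite [X in (X * _)%E]integral_a_len muleA -EFinM.
Qed.

(** The identity for [coupling_X] is a statement about integrals that does not presuppose a
    probability, so testing it on the constant 1 yields the total mass. *)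
Let q1 : (\int[lam4]_z coupling_pdf z = 1)%E.
Proof.
have := @integral_coupling_X (cst 1%E); rewrite integral_itv_cst// subr0 mule1 => H.
rewrite -H//; apply: eq_integral => z _; by rewrite mule1.
Qed.

(** * The probability space and its two uniform variables *)

Variable F : probability mR R.
Hypothesis FE : forall B : set R, measurable B ->
  (F B = (m / (2 * h))%:E * \int[lam]_(x in `[(- h)%R, h[) (\1_B (1 + x))%:E +
   \int[lam]_x ((g x)%:E * (\1_B (1 + x))%:E))%E.

Let P : probability mR4 R := density_prob mq q0 q1.

Let mX2 : measurable_fun setT (fun z => 1 - coupling_Y z).
Proof. exact: measurable_funB. Qed.

Let lawE (Z : mR4 -> R) (B : set R) : measurable_fun setT Z -> measurable B ->
  (pushforward P Z B = \int[lam4]_z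
     (coupling_pdf z * (\1_B (Z z))%:E))%E.
Proof.
move=> mZ mB; rewrite /pushforward /P/= density_probE; last first.
  by rewrite -[X in measurable X]setTI; exact: mZ.
by apply: eq_integral => z _; rewrite !indicE.
Qed.

(** The reflection x -> 1 - x preserves the uniform law, so [X2 = 1 - Y] is uniform along with Y,
    and the sum is 1 + (X - Y). The space is atomless because it carries the uniform variable
    [X1]. *)
Lemma D2U_assembly : D2U F.
Proof.
pose X1 : {RV P >-> R} := HB.pack coupling_X (isMeasurableFun.Build _ _ _ _ _ mX).
pose X2 : {RV P >-> R} := HB.pack (fun z => 1 - coupling_Y z) (isMeasurableFun.Build _ _ _ _ _ mX2).
have mI (B : set R) : measurable B -> measurable_fun setT (fun x => (\1_B x)%:E : \bar R).
  by move=> mB; apply/measurable_EFinP; exact: measurable_indic.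
have I0 (B : set R) x : (0 <= (\1_B x)%:E :> \bar R)%E by rewrite lee_fin.
have m1D : measurable_fun setT (fun x : R => 1 + x) by exact: measurable_funD.
have m1B : measurable_fun setT (fun x : R => 1 - x) by exact: measurable_funB.
have law1 : has_law P X1 (uniform_prob (@ltr01 R)).
  move=> B mB; rewrite [LHS](lawE mX mB) [RHS](uniform_prob01E mB).
  by rewrite (integral_coupling_X (G := fun x => (\1_B x)%:E))//; exact: mI.
have law2 : has_law P X2 (uniform_prob (@ltr01 R)).
  move=> B mB; rewrite [LHS](lawE mX2 mB) [RHS](uniform_prob01E mB).
  rewrite (integral_coupling_Y (G := fun x => (\1_B (1 - x))%:E))//; last first.
    exact: measurableT_comp (mI _ mB) m1B.
  rewrite (@integral_itv_opp _ 0 1 (fun x => (\1_B (1 + x))%:E))//; last first.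
    exact: measurableT_comp (mI _ mB) m1D.
  under eq_integral do rewrite addrC.
  rewrite (@integral_itv_shift _ _ _ 1 (fun x => (\1_B x)%:E))//; last exact: mI.
  by rewrite oppr0 add0r addNr.
exists _, _, P, X1, X2; split => //; first exact: (atomless_uniform law1).
move=> B mB; rewrite FE// [LHS](lawE (measurable_funD mX mX2) mB).
rewrite -(integral_coupling_sub (G := fun x => (\1_B (1 + x))%:E))//.
  by apply: eq_integral => z _ /=; congr (_ * (\1_B _)%:E)%E; ring.
exact: measurableT_comp (mI _ mB) m1D.
Qed.

End assembly.

(** * The centered density *)

Section density_facts.
Context (R : realType).

Lemma integral_gt0_itv (a b : R) (psi : R -> R) : a < b -> measurable_fun setT psi ->
  (forall x, 0 <= psi x) -> (forall x, a < x < b -> 0 < psi x) ->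
  (0 < \int[lam]_x (psi x)%:E)%E.
Proof.
move=> ab mpsi psi0 psi_gt0; rewrite lt0e integral_ge0 ?andbT; last first.
  by move=> x _; rewrite lee_fin.
apply/eqP => I0.
have : (\int[lam]_x `|(psi x)%:E| = 0)%E.
  by rewrite -I0; apply: eq_integral => x _; rewrite gee0_abs// lee_fin.
have mE : measurable_fun setT (EFin \o psi) by exact/measurable_EFinP.
move=> /(ae_eq_integral_abs lam measurableT mE) [N [mN N0 sN]].
have : (lam `]a, b[ <= lam N)%E.
  apply: le_measure; rewrite ?inE// => x /=; rewrite in_itv/= => xab.
  apply: sN => /= /(_ Logic.I) [] E.
  by have := psi_gt0 _ xab; rewrite E ltxx.
by rewrite N0 lebesgue_measure_itv/= lte_fin ab -EFinB lee_fin subr_le0 leNgt ab.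
Qed.

(** The centered variable has integral zero, the difference of the integrals of its positive and
    negative parts. Finiteness is kept in the conclusion because the uniform part will have to be
    cancelled from both sides. *)
Lemma mean_balance (F : probability (measurableTypeR R) R) (c : R) :
  (\int[F]_x x%:E = c%:E)%E ->
  (\int[F]_x (Num.max (x - c) 0)%:E = \int[F]_x (Num.max (c - x) 0)%:E)%E /\
  (\int[F]_x (Num.max (x - c) 0)%:E < +oo)%E.
Proof.
move=> Fc.
have mid : measurable_fun setT (id : measurableTypeR R -> R) by [].
(* A finite value of the integral rules out an infinite positive or negative part, so the mean
   hypothesis already contains integrability. *)
have iid : F.-integrable setT (fun x : measurableTypeR R => x%:E).
  apply/integrableP; split; first exact/measurable_EFinP.
  by rewrite (@integral_fin_num_abs _ _ _ F setT id)// Fc.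
have ic : F.-integrable setT (EFin \o cst c) by exact: finite_measure_integrable_cst.
have iB := integrableB measurableT iid ic.
have : (\int[F]_x (x%:E - (EFin \o cst c) x) = 0)%E.
  have -> : (\int[F]_x (x%:E - (EFin \o cst c) x) =
      \int[F]_x x%:E - \int[F]_x (cst c%:E) x)%E by exact: integralB.
  by rewrite Fc integral_cst// [X in (_ * X)%E](probability_setT F) mule1 subee.
rewrite integralE.
have -> : (\int[F]_x (fun x : measurableTypeR R => (x%:E - (EFin \o cst c) x)%E)^\+ x =
    \int[F]_x (Num.max (x - c) 0)%:E)%E.
  by apply: eq_integral => x _; rewrite funeposE -EFinB EFin_max.
have -> : (\int[F]_x (fun x : measurableTypeR R => (x%:E - (EFin \o cst c) x)%E)^\- x =
    \int[F]_x (Num.max (c - x) 0)%:E)%E.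
  by apply: eq_integral => x _; rewrite funenegE -EFinB -EFinN opprB EFin_max.
have pfin : (\int[F]_x (Num.max (x - c) 0)%:E < +oo)%E.
  apply: (@le_lt_trans _ _ (\int[F]_x `|x%:E - (EFin \o cst c) x|)%E).
    apply: ge0_le_integral => //.
    - by move=> x _; rewrite lee_fin le_max lexx orbT.
    - apply/measurable_EFinP; apply: measurable_maxr => //; exact: measurable_funB.
    - apply: measurableT_comp => //; apply/measurable_EFinP; exact: measurable_funB.
    - by move=> x _; rewrite -EFinB lee_fin ge_max ler_norm normr_ge0.
  by have /integrableP[] := iB.
have p0 : (0 <= \int[F]_x (Num.max (x - c) 0)%:E)%E.
  by apply: integral_ge0 => x _; rewrite lee_fin le_max lexx orbT.
have n0 : (0 <= \int[F]_x (Num.max (c - x) 0)%:E)%E.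
  by apply: integral_ge0 => x _; rewrite lee_fin le_max lexx orbT.
move: pfin p0 n0.
set pI := (\int[F]_x (Num.max (x - c) 0)%:E)%E.
set nI := (\int[F]_x (Num.max (c - x) 0)%:E)%E.
case: pI => [r| |] // _ _; case: nI => [s| |] // _; rewrite -EFinB => -[rs].
by split; rewrite ?ltry//; congr EFin; move: rs; lra.
Qed.

(** A density may be nonzero on a null set outside the support. The bound u + v <= b on the pairs is
    needed pointwise, hence this choice of a version vanishing there. *)
Lemma is_density_support (F : probability (measurableTypeR R) R) (f : R -> R)
    (S : set R) : measurable S -> F S = 1%E -> is_density F f ->
  is_density F (fun x => f x * \1_S x).
Proof.
move=> mS FS [mf f0 fE]; split.
- by apply: measurable_funM => //; exact: measurable_indic.
- by move=> x; rewrite mulr_ge0.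
- move=> B mB.
  have FSc : F (~` S) = 0%E by rewrite probability_setC// FS subee.
  transitivity (F (B `&` S)).
    have FBS : F (B `\` S) = 0%E.
      apply/eqP; rewrite eq_le measure_ge0 andbT -FSc.
      by apply: le_measure; rewrite ?inE; [exact: measurableD|exact: measurableC|move=> x []].
    by rewrite (measureDI F mB mS) [X in (X + _)%E]FBS add0e.
  rewrite fE; last exact: measurableI.
  rewrite integral_mkcondr; apply: eq_integral => x _.
  by rewrite patchE indicE; case: ifP; rewrite ?mulr1 ?mulr0.
Qed.

(** An interval missing [S] has probability zero, whereas a positive density gives it positive mass.
    This is what places [1 - h, 1 + h] inside the support interval. *)
Lemma density_itv_meets (F : probability (measurableTypeR R) R) (f : R -> R)
    (S : set R) (x y : R) : measurable S -> F S = 1%E -> is_density F f ->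
  x < y -> (forall z, x < z < y -> 0 < f z) -> exists2 z, S z & x < z < y.
Proof.
move=> mS FS [mf f0 fE] xy fpos; apply: contrapT => noz.
have FSc : F (~` S) = 0%E by rewrite probability_setC// FS subee.
have : (F `]x, y[%classic <= 0)%E.
  rewrite -FSc; apply: le_measure; rewrite ?inE//; first exact: measurableC.
  by move=> z /=; rewrite in_itv/= => xzy Sz; apply: noz; exists z.
apply/negP; rewrite -ltNge fE//.
have : (0 < \int[lam]_z (f z * \1_`]x, y[ z)%:E)%E.
  apply: (integral_gt0_itv xy).
  - by apply: measurable_funM => //; exact: measurable_indic.
  - by move=> z; rewrite mulr_ge0.
  - by move=> z xzy; rewrite indicE mem_set ?mulr1 ?fpos//= in_itv.
congr (0 < _)%E; rewrite [RHS]integral_mkcond; apply: eq_integral => z _.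
by rewrite patchE indicE; case: ifP; rewrite ?mulr1 ?mulr0.
Qed.

End density_facts.

(** * Splitting off the uniform part and checking the conditions on the remainder *)

Theorem theorem3p3 (R : realType) (a b : R) (hb : 0 < b)
    (F : probability (measurableTypeR R) R) (f : R -> R)
    (Fsupp : F `[a, a + b]%classic = 1%E)
    (Fmean : (\int[F]_x x%:E = 1)%E)
    (Ff : is_density F f)
    (hf : exists2 h : R, 0 < h &
      forall x : R, 1 - h <= x <= 1 + h -> 3 * b / (4 * h) < f x) :
  D2U F.
Proof.
have [h h0 fc] := hf; pose c := 3 * b / (4 * h).
have c0 : 0 < c by rewrite divr_gt0// mulr_gt0.
have mS : measurable (`[a, a + b] : set R) by [].
have meets x y : 1 - h <= x -> y <= 1 + h -> x < y -> exists2 z, a <= z <= a + b & x < z < y.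
  move=> hx hy xy; have [|z] := density_itv_meets mS Fsupp Ff xy.
    by move=> z /andP[xz zy]; apply: lt_trans (fc z _) => //; apply/andP; split; lra.
  by rewrite /= in_itv/=; exists z.
(* If 1 - h < a, the density would be positive on the interval from 1 - h to min(a, 1 + h), which
   lies outside [a, a + b]. The minimum keeps the interval within the range where [f] is bounded
   below; the right end is treated symmetrically. *)
have a1h : a <= 1 - h.
  rewrite leNgt; apply/negP => lt.
  have [||z /andP[az _] /andP[_]] := meets (1 - h) (Num.min a (1 + h)) (lexx _).
  - by rewrite ge_min lexx orbT.
  - by rewrite lt_min lt; lra.
  - by rewrite lt_min ltNge az.
have ha1 : 1 + h <= a + b.
  rewrite leNgt; apply/negP => lt.
  have [||z /andP[_ zab] /andP[+ _]] := meets (Num.max (a + b) (1 - h)) (1 + h) _ (lexx _).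
  - by rewrite le_max lexx orbT.
  - by rewrite gt_max lt; lra.
  - by rewrite gt_max ltNge zab.
pose f1 x := f x * \1_(`[a, a + b] : set R) x.
have Ff1 : is_density F f1 := is_density_support mS Fsupp Ff.
have [mf1 f10 f1E] := Ff1.
have f1S x : a <= x <= a + b -> f1 x = f x.
  by move=> xS; rewrite /f1 indicE mem_set ?mulr1//= in_itv.
have f1nS x : ~~ (a <= x <= a + b) -> f1 x = 0.
  by move=> xS; rewrite /f1 indicE memNset ?mulr0//= in_itv/=; exact/negP.
pose box z : R := if - h <= z < h then 1 else 0.
have mbox : measurable_fun setT box.
  apply: measurable_fun_ifT => //.
  by apply: measurable_and; [exact: measurable_fun_ler|exact: measurable_fun_ltr].
pose g z := f1 (1 + z) - c * box z.
have m1D : measurable_fun setT (fun x : R => 1 + x) by exact: measurable_funD.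
have mg : measurable_fun setT g.
  by apply: measurable_funB; [exact: measurableT_comp|exact: measurable_funM].
have g_gt0 z : - h <= z < h -> 0 < g z.
  move=> zh; rewrite /g /box zh mulr1 subr_gt0 f1S; last by apply/andP; split; lra.
  by apply: fc; apply/andP; split; lra.
have g0 z : 0 <= g z.
  have [/g_gt0/ltW//|zh] := boolP (- h <= z < h).
  by rewrite /g /box (negbTE zh) mulr0 subr0.
have gS z : g z != 0 -> a <= 1 + z <= a + b.
  apply: contraR => zS; rewrite /g f1nS// /box ifF ?mulr0 ?subrr//.
  by apply: contraNF zS => zh; apply/andP; split; lra.
have split_g (G : R -> \bar R) : measurable_fun setT G -> (forall x, (0 <= G x)%E) ->
    (\int[lam]_z ((f1 (1 + z))%:E * G z) =
     c%:E * \int[lam]_(z in `[(- h)%R, h[) G z + \int[lam]_z ((g z)%:E * G z))%E.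
  move=> mG G0; rewrite integral_itv_if -ge0_integralZl//; last 3 first.
  - exact: measurable_if_itv.
  - by move=> x _; case: ifP.
  - by rewrite lee_fin ltW.
  rewrite -ge0_integralD//; last 4 first.
  - by move=> z _; rewrite mule_ge0 ?lee_fin ?(ltW c0)//; case: ifP.
  - by apply: emeasurable_funM => //; exact: measurable_if_itv.
  - by move=> z _; rewrite mule_ge0// lee_fin.
  - by apply: emeasurable_funM => //; exact/measurable_EFinP.
  apply: eq_integral => z _.
  have -> : f1 (1 + z) = c * box z + g z by rewrite /g; ring.
  rewrite EFinD ge0_muleDl; last 2 first.
  - by rewrite lee_fin mulr_ge0 ?(ltW c0)// /box; case: ifP.
  - by rewrite lee_fin.
  congr (_ + _)%E; rewrite /box; case: ifP => _; first by rewrite mulr1.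
  by rewrite mulr0 mul0e mule0.
pose m := 3 * b / 2.
have mc : m / (2 * h) = c by rewrite /m /c; field; rewrite gt_eqF.
have FE (B : set R) : measurable B ->
    (F B = (m / (2 * h))%:E * \int[lam]_(x in `[(- h)%R, h[) (\1_B (1 + x))%:E +
     \int[lam]_x ((g x)%:E * (\1_B (1 + x))%:E))%E.
  move=> mB; have mI : measurable_fun setT (fun x => (\1_B x)%:E : \bar R).
    by apply/measurable_EFinP; exact: measurable_indic.
  rewrite mc -(split_g (fun x => (\1_B (1 + x))%:E))//; last exact: measurableT_comp mI m1D.
  under eq_integral do rewrite addrC.
  rewrite (@ge0_integral_shift _ 1 (fun x => (f1 x)%:E * (\1_B x)%:E)%E); last 2 first.
  - by apply: emeasurable_funM => //; exact/measurable_EFinP.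
  - by move=> x; rewrite mule_ge0// lee_fin.
  rewrite f1E// integral_mkcond; apply: eq_integral => x _.
  by rewrite patchE indicE; case: ifP; rewrite ?mule1 ?mule0.
have gmass : (\int[lam]_x (g x)%:E = (1 - m)%:E)%E.
  have := FE setT measurableT; rewrite probability_setT.
  rewrite !indicT /=.
  rewrite integral_itv_cst; last by lra.
  under eq_integral do rewrite mule1.
  rewrite mule1 -EFinM (_ : m / (2 * h) * (h - - h) = m); last by field; rewrite gt_eqF.
  have I0 : (0 <= \int[lam]_x (g x)%:E)%E by apply: integral_ge0 => x _; rewrite lee_fin.
  case: (integral _ _ _) I0 => [r _|//|//]; rewrite -EFinD => -[rE].
  by congr EFin; rewrite rE; ring.
(* The lower bound on [f] is strict, so [g] is positive on ]0, h[ and its total mass 1 - m is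
   positive. *)
have m1 : m < 1.
  have : (0 < \int[lam]_x (g x)%:E)%E.
    apply: (integral_gt0_itv h0 mg g0) => x /andP[x0 xh].
    by apply: g_gt0; rewrite xh andbT; lra.
  by rewrite gmass lte_fin; lra.
pose gp (z : R) := Num.max z 0; pose gn (z : R) := Num.max (- z) 0.
have mgp : measurable_fun setT gp by exact: measurable_maxr.
have mgn : measurable_fun setT gn by apply: measurable_maxr.
have gp0 x : 0 <= gp x by rewrite le_max lexx orbT.
have gn0 x : 0 <= gn x by rewrite le_max lexx orbT.
have balance (k : R -> R) : measurable_fun setT k -> (forall x, 0 <= k x) ->
    (\int[F]_x (k (x - 1))%:E = c%:E * \int[lam]_(z in `[(- h)%R, h[) (k z)%:E +
       \int[lam]_z ((g z)%:E * (k z)%:E))%E.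
  move=> mk k0.
  rewrite (@ge0_integral_density R F f1 (fun x => k (x - 1)) Ff1)//; last first.
    by apply: measurableT_comp => //; exact: measurable_funB.
  rewrite -split_g; last 2 first.
  - exact/measurable_EFinP.
  - by move=> x; rewrite lee_fin.
  rewrite -(@ge0_integral_shift _ 1 (fun x => (f1 x * k (x - 1))%:E)).
  - by apply: eq_integral => z _; rewrite addrK EFinM addrC.
  - apply/measurable_EFinP; apply: measurable_funM => //.
    by apply: measurableT_comp => //; exact: measurable_funB.
  - by move=> x; rewrite lee_fin mulr_ge0.
have [kE kfin] := mean_balance Fmean.
have pE := balance gp mgp gp0.
have nE := balance gn mgn gn0.
have kap : exists2 kappa : R, (\int[lam]_z ((g z)%:E * (gp z)%:E) = kappa%:E)%E &
    (\int[lam]_z ((g z)%:E * (gn z)%:E) = kappa%:E)%E.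
  have mpE : (\int[F]_x (gp (x - 1))%:E = \int[F]_x (gn (x - 1))%:E)%E.
    by rewrite /gp /gn kE; apply: eq_integral => x _; rewrite opprB.
  have mpfin : (\int[F]_x (gp (x - 1))%:E < +oo)%E by [].
  (* By symmetry the uniform part contributes the same amount to both half moments of F - 1. That
     amount is finite, so it cancels and leaves the equality of the half moments of [g]. *)
  have symE : (\int[lam]_(z in `[(- h)%R, h[) (gn z)%:E =
      \int[lam]_(z in `[(- h)%R, h[) (gp z)%:E)%E.
    rewrite (@integral_itv_opp _ (- h) h (EFin \o gp))//= ?opprK//.
    exact/measurable_EFinP.
  move: mpE mpfin; rewrite pE nE symE.
  have : (0 <= c%:E * \int[lam]_(z in `[(- h)%R, h[) (gp z)%:E)%E.
    by rewrite mule_ge0 ?lee_fin ?(ltW c0)//; apply: integral_ge0 => x _; rewrite lee_fin.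
  have : (0 <= \int[lam]_z ((g z)%:E * (gp z)%:E))%E.
    by apply: integral_ge0 => x _; rewrite mule_ge0// lee_fin.
  have : (0 <= \int[lam]_z ((g z)%:E * (gn z)%:E))%E.
    by apply: integral_ge0 => x _; rewrite mule_ge0// lee_fin.
  move: (c%:E * _)%E (\int[lam]_z ((g z)%:E * (gp z)%:E))%E
    (\int[lam]_z ((g z)%:E * (gn z)%:E))%E.
  move=> [w| |] [r| |] [s| |] // _ _ _; rewrite -!EFinD => -[ws] _.
  by exists r => //; congr EFin; move: ws; lra.
have [kappa kp kn] := kap.
have mpos (u : R -> R) x : x * pos_part u x = u x * gp x.
  by rewrite /pos_part /gp; case: ltP => x0; [rewrite mulrC|rewrite !mulr0].
have kappap : (\int[lam]_x (x * pos_part g x)%:E = kappa%:E)%E.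
  by rewrite -kp; apply: eq_integral => x _; rewrite mpos EFinM.
have kappam : (\int[lam]_x (x * pos_part (fun u => g (- u)) x)%:E = kappa%:E)%E.
  rewrite -kn -[RHS]ge0_integral_opp.
  - by apply: eq_integral => x _; rewrite mpos EFinM /gn opprK.
  - by apply: emeasurable_funM; exact/measurable_EFinP.
  - by move=> x; rewrite mule_ge0// lee_fin.
(* Strict positivity of [g] on ]0, h[ is used again, now with the weight x. *)
have kappa0 : 0 < kappa.
  rewrite -lte_fin -kp; have : (0 < \int[lam]_z (g z * gp z)%:E)%E.
    apply: (integral_gt0_itv h0) => [|x|x /andP[x0 xh]].
    - exact: measurable_funM.
    - by rewrite mulr_ge0.
    - by rewrite mulr_gt0 ?lt_max ?x0// g_gt0// xh andbT; lra.
  by under eq_integral do rewrite EFinM.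
(* The inclusion of [1 - h, 1 + h] in [a, a + b] gives 2h <= b, hence h + b <= 3b/2 = m < 1. When
   g(-u) and g(v) are nonzero, 1 - u and 1 + v both lie in [a, a + b], so u + v <= b. *)
apply: (@D2U_assembly R g h b kappa m) => //.
- by rewrite (le_lt_trans _ m1)// /m; lra.
- by move=> u v u0 v0 /gS/andP[au _] /gS/andP[_ vab]; lra.
- by rewrite /m; lra.
Qed.
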